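(* Under partial information feedback, the OGD-CB algorithm $\beta$ guarantees \[\liminf_{T\to\infty,\ B=\rho T}\ \inf_{\bm v,\,G}\ \frac1T\,\mathbb E_{\bm p\sim G^T}\Big[R^\beta(\bm v,\bm p)-\frac{\rho}{\bar v}\,R^{\mathrm H}(\bm v,\bm p)\Big]\ \ge 0,\] where the infimum is over value sequences $\bm v\in[0,\bar v]^T$ and distributions $G$ on $[0,\bar v]$.
   Context: Model: constants $\bar v>0$, $\rho\in(0,\bar v]$; $T$ rounds; budget $B=\rho T$. Round $t$: value $v_t\in[0,\bar v]$ (an arbitrary, adversarial sequence); highest competing bid $p_t$ i.i.d. from an unknown distribution $G$ on $[0,\bar v]$. Buyer chooses $x_t\in\{0,1\}$, receives $x_tr_t$ with $r_t=(v_t-p_t)^+$, pays $x_tc_t$ with $c_t=p_t\mathbf 1[v_t\ge p_t]$. Partial information: $p_t$ observed only when $x_t=1$. Revenue $R^\beta(\bm v,\bm p)=\sum_{t=1}^{T_0}x_tr_t$, $T_0$ the ending time. Hindsight benchmark: $R^{\mathrm H}(\bm v,\bm p)=\max_{\bm x\in\{0,1\}^T}\sum_tx_t(v_t-p_t)^+$ s.t. $\sum_tx_tp_t\mathbf 1[v_t\ge p_t]\le T\rho$. OGD-CB algorithm: $\mathcal I_1=\emptyset$, $B_1=B$, $\lambda_1=0$. For $t=1,\dots,T$: observe $v_t$. If $t=1$: $x_1=1$, $\lambda_2=\lambda_1$. Otherwise: $\epsilon_t=\sqrt{(\ln 2+2\ln T)/(2|\mathcal I_t|)}$; $\tilde r_t(v)=\frac1{|\mathcal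 I_t|}\sum_{\tau\in\mathcal I_t}(v-p_\tau)^++\epsilon_tv$; $\tilde c_t(v)=\frac1{|\mathcal I_t|}\sum_{\tau\in\mathcal I_t}p_\tau\mathbf 1[v\ge p_\tau]-2\epsilon_tv$; $x_t=\mathbf 1[\tilde r_t(v_t)\ge\lambda_t\tilde c_t(v_t)]$; $\eta_t=1/(\bar v\sqrt t)$; $\lambda_{t+1}=(\lambda_t+\eta_t(x_t\tilde c_t(v_t)-\rho))^+$. If $x_t=1$, observe $p_t$ and set $\mathcal I_{t+1}=\mathcal I_t\cup\{t\}$, else $\mathcal I_{t+1}=\mathcal I_t$. Set $B_{t+1}=B_t-x_tc_t$; if $B_{t+1}<\bar v$, stop; $T_0$ is the stopping round (or $T$). *)

(* Defs.v *)
From HB Require Import structures.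
From mathcomp Require Import all_boot all_order all_algebra.
From mathcomp Require Import all_classical all_reals all_analysis.
Set Implicit Arguments. Unset Strict Implicit. Unset Printing Implicit Defensive.
Import Order.TTheory GRing.Theory Num.Theory.
Import numFieldNormedType.Exports.
Local Open Scope classical_set_scope.
Local Open Scope ring_scope.

Section OGDCB.
Variable R : realType.

Definition pospart (a : R) : R := Num.max a 0.

Definition rew (v p : R) : R := pospart (v - p).
Definition cost (v p : R) : R := if p <= v then p else 0.

Record ogd_state := OGDState {
  st_lam : R;
  st_obs : seq R;
  st_bud : R;
  st_rev : R;
  st_stopped : bool }.

(* One round t (1-based) of OGD-CB, for horizon T, with values v and
   highest competing bids p (both indexed by rounds 1..T). *)
Definition ogd_step (vbar rho : R) (T : nat) (v p : nat -> R)
    (s : ogd_state) (t : nat) : ogd_state :=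
  if st_stopped s then s else
  let vt := v t in
  let pt := p t in
  let xl :=
    if t == 1%N then (true, st_lam s) else
    let n := (size (st_obs s))%:R in
    let eps := Num.sqrt ((ln 2 + 2 * ln T%:R) / (2 * n)) in
    let rt := (\sum_(q <- st_obs s) rew vt q) / n + eps * vt in
    let ct := (\sum_(q <- st_obs s) cost vt q) / n - 2 * eps * vt in
    let x := st_lam s * ct <= rt in
    let eta := 1 / (vbar * Num.sqrt t%:R) in
    (x, Num.max (st_lam s + eta * ((if x then ct else 0) - rho)) 0) in
  let x := xl.1 in
  let B' := if x then st_bud s - cost vt pt else st_bud s in
  OGDState xl.2
           (if x then rcons (st_obs s) pt else st_obs s)
           B'
           (st_rev s + (if x then rew vt pt else 0))
           (B' < vbar).

Definition ogd_revenue (vbar rho : R) (T : nat) (v p : nat -> R) : R :=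
  st_rev (foldl (ogd_step vbar rho T v p)
                (OGDState 0 [::] (rho * T%:R) 0 false) (iota 1 T)).

(* hindsight benchmark R^H(v, p) : max over x in {0,1}^T of
   sum_t x_t r_t subject to sum_t x_t c_t <= T rho.
   (x = 0 is feasible and all objective values are >= 0, so the
   big max with neutral element 0 is exactly the maximum.) *)
Definition hindsight (rho : R) (T : nat) (v p : nat -> R) : R :=
  \big[Num.max/0]_(x : {ffun 'I_T -> bool} |
        \sum_(i < T) (x i)%:R * cost (v i.+1) (p i.+1) <= T%:R * rho)
     \sum_(i < T) (x i)%:R * rew (v i.+1) (p i.+1).

Fixpoint iid_expect (G : {measure set R -> \bar R}) (n : nat)
    (f : seq R -> R) : R :=
  match n with
  | 0%N => f [::]
  | n'.+1 => Rintegral G setT (fun q => iid_expect G n' (fun ps => f (q :: ps)))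
  end.

Definition bids_of (ps : seq R) : nat -> R := fun t => nth 0 ps t.-1.

End OGDCB.

(* Main.v *)
Require Import Defs.
From HB Require Import structures.
From mathcomp Require Import all_boot all_order all_algebra.
From mathcomp Require Import all_classical all_reals all_analysis.
From mathcomp Require Import measurable_realfun ring lra.
Set Implicit Arguments. Unset Strict Implicit. Unset Printing Implicit Defensive.
Import Order.TTheory GRing.Theory Num.Theory.
Import numFieldNormedType.Exports.
Local Open Scope classical_set_scope.
Local Open Scope ring_scope.

(* The benchmark is at most the sum of all rewards, and bidding at random with
   probability rho/vbar respects the budget in every round, because costs are at
   most vbar.  When the confidence bounds hold, the bid of OGD-CB maximizes the
   optimistic Lagrangian reward minus lambda times cost, hence does at least as
   well as this random bid; the radius is paid only in rounds with a bid, where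
   it decreases like 1/sqrt(number of bids), so it sums to
   O(sqrt(T log T)).  The regret of gradient descent on lambda, which stays
   O(sqrt(log T)), against the fixed multiplier 0 (budget never exhausted) or 1
   (budget exhausted) turns this into a bound on the revenue.

   Each random term is controlled by a function of the bid history that is a
   submartingale: the martingale parts of reward and cost, the compensated square
   of the latter, and for each round, each tail and each possible number n of
   observations an exponential supermartingale with the tilt tuned to n (Hoeffding).
   A union bound over n makes the expected number of rounds with a wrong
   confidence bound O(1), although the set of observed rounds is adaptive. *)

(** * Integral comparison without measurability *)

(* [iid_expect] iterates integrals of functions whose measurability in the
   remaining bids is never established, so monotonicity is needed without it. *)
Lemma ge0_le_integral_nonmeasurable (d : measure_display) (T : measurableType d)
    (R : realType) (mu : {measure set T -> \bar R}) (f1 f2 : T -> \bar R) :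
  (forall x, 0 <= f1 x)%E -> (forall x, f1 x <= f2 x)%E ->
  (\int[mu]_x f1 x <= \int[mu]_x f2 x)%E.
Proof.
move=> f10 f12.
have f20 x : (0 <= f2 x)%E by apply: le_trans (f12 x).
rewrite !ge0_integralTE//.
apply: ereal_sup_le => _ [h hf1 <-]; exists h => // x.
exact: le_trans (hf1 x) (f12 x).
Qed.

(** The value [+oo] on a null set costs nothing, and it makes the integrand dominate any function
    that is controlled only on [A]. *)
Lemma integral_top_off_null (d : measure_display) (T : measurableType d)
    (R : realType) (mu : {measure set T -> \bar R}) (A : set T) (w : T -> \bar R) :
  measurable A -> mu (~` A) = 0%E -> measurable_fun A w ->
  (forall x, A x -> 0 <= w x)%E ->
  (\int[mu]_x (if x \in A then w x else +oo) = \int[mu]_(x in A) w x)%E.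
Proof.
move=> mA muA mw w0.
have mC : measurable (~` A) by exact: measurableC.
rewrite (ge0_negligible_integral mC)//; last 2 first.
- rewrite -(setUv A); apply/measurable_funU => //; split.
    by apply: eq_measurable_fun mw => x xA; rewrite xA.
  apply: (eq_measurable_fun (cst +oo%E)) => [x|]; last exact: measurable_cst.
  by rewrite in_setC => /negbTE ->.
- by move=> x _; case: ifPn => [|_]; [rewrite inE => /w0|rewrite leey].
by rewrite setTD setCK; apply: eq_integral => x ->.
Qed.

(** [F] need not be measurable: its positive and negative parts are compared separately with those
    of [g] and with [K], where [0 <= K] lets [K] bound the positive part too. Functions that must
    lie above [F] off [A] are set to [+oo] there. *)
Lemma Rintegral_sandwich (d : measure_display) (T : measurableType d)
    (R : realType) (mu : probability T R) (A : set T) (g F : T -> R) (K : R) :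
  measurable A -> mu A = 1%E -> 0 <= K ->
  mu.-integrable A (EFin \o g) ->
  (forall x, A x -> g x <= F x) -> (forall x, A x -> F x <= K) ->
  \int[mu]_(x in A) g x <= \int[mu]_x F x <= K.
Proof.
move=> mA muA K0 ig gF FK.
have muC : mu (~` A) = 0%E by rewrite probability_setC// muA subee.
have mg : measurable_fun A (EFin \o g) by case/integrableP : ig.
have lo : (\int[mu]_(x in A) (g x)%:E <= \int[mu]_x (F x)%:E)%E.
  rewrite integralE [leRHS]integralE; apply: leeB.
    rewrite integral_mkcond; apply: ge0_le_integral_nonmeasurable => x.
      by apply: erestrict_ge0 => y _; exact: funepos_ge0.
    rewrite /patch; case: ifPn => [/set_mem Ax|_]; last exact: funepos_ge0.
    rewrite !funeposE /= ge_max !le_max !lee_fin gF//= lexx ?orbT//.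
  have E := integral_top_off_null mA muC (measurable_funeneg mg)
    (fun x _ => funeneg_ge0 (EFin \o g) x).
  rewrite -E.
  apply: ge0_le_integral_nonmeasurable => x; first exact: funeneg_ge0.
  case: ifPn => [/set_mem Ax|_]; last by rewrite leey.
  by rewrite !funenegE ge_max !le_max -!EFinN !lee_fin lerN2 gF//= lexx orbT.
have hi : (\int[mu]_x (F x)%:E <= K%:E)%E.
  rewrite integralE -[leRHS]sube0; apply: leeB; last first.
    by apply: integral_ge0 => x _; exact: funeneg_ge0.
  apply: (@le_trans _ _ (\int[mu]_(x in A) (K%:E))%E); last first.
    by rewrite integral_cst// [X in (_ * X)%E]muA mule1.
  rewrite -(integral_top_off_null mA muC)//.
  apply: ge0_le_integral_nonmeasurable => x; first exact: funepos_ge0.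
  case: ifPn => [/set_mem Ax|_]; last by rewrite leey.
  by rewrite !funeposE ge_max !lee_fin FK.
(* [Rintegral] sends an infinite integral to 0, so both integrals must be known to be finite before
   the bounds can pass to real numbers. *)
have gfin : (\int[mu]_(x in A) (g x)%:E)%E \is a fin_num.
  exact: integrable_fin_num.
have Ffin : (\int[mu]_x (F x)%:E)%E \is a fin_num.
  rewrite fin_numElt (lt_le_trans _ lo) ?(le_lt_trans hi) ?ltry//.
  by move: gfin; rewrite fin_numElt => /andP[].
by rewrite /Rintegral fine_le//= -lee_fin fineK.
Qed.

(** * Exponential bounds and Hoeffding's lemma *)

Lemma ler_of_is_derive (R : realType) (f g df dg : R -> R) :
  (forall x : R, is_derive x (1 : R) f (df x)) ->
  (forall x : R, is_derive x (1 : R) g (dg x)) ->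
  f 0 <= g 0 -> (forall x, 0 <= x -> df x <= dg x) ->
  forall s, 0 <= s -> f s <= g s.
Proof.
move=> f' g' fg0 dfg s s0.
have h' (x : R) : is_derive x (1 : R) (g - f) (dg x - df x) by exact: is_deriveB.
suff : (g - f) 0 <= (g - f) s by rewrite /GRing.add/= /GRing.opp/=; lra.
apply: (@ger0_derive1_ndecr _ _ 0 s) => //.
- move=> x; rewrite in_itv/= => /andP[x0 _].
  by rewrite derive1E (@derive_val _ _ _ _ _ _ _ (h' x)); rewrite subr_ge0 dfg// ltW.
- apply: continuous_subspaceT => x; apply: differentiable_continuous.
  apply/derivable1_diffP; exact: (@ex_derive _ _ _ _ _ _ _ (h' x)).
Qed.

Lemma expR_chord (R : realType) (s x : R) : 0 <= x <= 1 ->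
  expR (s * x) <= 1 - x + x * expR s.
Proof.
move=> /andP[x0 x1].
have h := @convex_expR R (Itv01 x0 x1) s 0.
move: h; rewrite !convRE /= expR0 /unstable.onem mulr0 addr0 mulr1.
by rewrite mulrC addrC.
Qed.

(* The logarithm of the left-hand side has first derivative a logistic function
   of [s], whose slope is at most 1/4. *)
Lemma bernoulli_mgf_le (R : realType) (m s : R) : 0 <= m <= 1 -> 0 <= s ->
  1 - m + m * expR s <= expR (s * m + s ^+ 2 / 8).
Proof.
move=> /andP[m0 m1] s0.
pose D x : R := 1 - m + m * expR x.
have D0 x : 0 < D x.
  rewrite /D; have := expR_gt0 x; nra.
have dD (x : R) : is_derive x (1 : R) D (m * expR x).
  rewrite /D; apply: is_derive_eq; rewrite /GRing.scale/=; ring.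
pose q x := m * expR x / D x.
have dq (x : R) : is_derive x (1 : R) q (q x * (1 - q x)).
  have Dx := lt0r_neq0 (D0 x).
  have dV : is_derive x (1 : R) (fun y => (D y)^-1) (- (D x) ^- 2 *: (m * expR x)).
    exact: is_deriveV.
  apply: is_derive_eq; rewrite /q /GRing.scale/=.
  by move: Dx; rewrite /D => Dx; field.
have q_le x : 0 <= x -> q x <= m + x / 4.
  apply: (@ler_of_is_derive _ q (fun x => m + x / 4)
    (fun x => q x * (1 - q x)) (fun=> 4^-1)) => //.
  - by move=> y; apply: is_derive_eq; rewrite /GRing.scale/=; ring.
  - by rewrite /q /D expR0 mulr1 subrK divr1 mul0r addr0.
  - by move=> y _; have := sqr_ge0 (q y - 2^-1); move: (q y) => z; nra.
have dlnD (x : R) : is_derive x (1 : R) (fun y => ln (D y)) (q x).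
  have H := is_derive1_ln (D0 x).
  have := @is_derive1_comp R (@ln R) D x _ _ H (dD x).
  by rewrite /q mulrC.
have : ln (D s) <= s * m + s ^+ 2 / 8.
  apply: (@ler_of_is_derive _ (fun y => ln (D y)) (fun x => x * m + x ^+ 2 / 8)
    q (fun x => m + x / 4)) => //.
  - by move=> y; apply: is_derive_eq; rewrite /GRing.scale/=; field.
  - by rewrite /D expR0 mulr1 subrK ln1; lra.
by rewrite -ler_expR lnK ?posrE//.
Qed.

Section integrals.
Context (d : measure_display) (T : measurableType d) (R : realType).
Variables (P : probability T R) (A : set T).
Hypotheses (mA : measurable A) (PA : P A = 1%E).

Lemma bounded_integrable (g : T -> R) (M : R) :
  measurable_fun A g -> (forall x, A x -> `|g x| <= M) ->
  P.-integrable A (EFin \o g).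
Proof.
move=> mg gM; apply: measurable_bounded_integrable => //.
  by rewrite [ltLHS]PA ltry.
exists M; split; first exact: num_real.
by move=> x Mx y Ay /=; rewrite (le_trans (gM _ Ay))// ltW.
Qed.

Lemma Rintegral_prob_cst (r : R) : \int[P]_(x in A) r = r.
Proof. by rewrite Rintegral_cst// [X in fine X]PA /= mulr1. Qed.

Lemma Rintegral_bounds (g : T -> R) (a b : R) : P.-integrable A (EFin \o g) ->
  (forall x, A x -> a <= g x <= b) -> a <= \int[P]_(x in A) g x <= b.
Proof.
move=> ig gab.
have ic (r : R) : P.-integrable A (EFin \o cst r).
  by apply: (@bounded_integrable _ `|r|) => //; exact: measurable_cst.
apply/andP; split.
  rewrite -[leLHS]Rintegral_prob_cst.
  by apply: le_Rintegral => // [|x /gab /andP[]//]; exact: ic.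
rewrite -[leRHS]Rintegral_prob_cst.
by apply: le_Rintegral => // [|x /gab /andP[]//]; exact: ic.
Qed.

(** The exponential lies below its chord on the range of [X], and the mean of the chord is the
    moment generating function of a Bernoulli variable of mean [m]. Keeping the compensator
    [s ^+ 2 / 8] inside the exponent yields a factor of mean at most 1, ready to be multiplied along
    a history. *)
Lemma Hoeffding_lemma (X : T -> R) (s : R) :
  measurable_fun A X -> (forall x, A x -> 0 <= X x <= 1) -> 0 <= s ->
  \int[P]_(x in A) expR (s * (X x - \int[P]_(y in A) X y) - s ^+ 2 / 8) <= 1.
Proof.
move=> mX X01 s0.
have iX : P.-integrable A (EFin \o X).
  by apply: (@bounded_integrable _ 1) => // x /X01 /andP[? ?]; rewrite ger0_norm.
set m := \int[P]_(y in A) X y.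
have m01 : 0 <= m <= 1 by exact: Rintegral_bounds.
pose c := expR (- (s * m + s ^+ 2 / 8)).
have c0 : 0 <= c by exact: expR_ge0.
have i1 : P.-integrable A (EFin \o cst (1 : R)).
  by apply: (@bounded_integrable _ 1) => [|x _ /=]; [exact: measurable_cst|rewrite normr1].
have iE : P.-integrable A (EFin \o (fun x => X x * (expR s - 1))).
  apply: (@bounded_integrable _ `|expR s - 1|).
    by apply: measurable_funM => //; exact: measurable_cst.
  move=> x /X01 /andP[x0 x1].
  by rewrite normrM (ger0_norm x0) ler_piMl.
have iF : P.-integrable A (EFin \o (fun x => 1 + X x * (expR s - 1))).
  exact: (integrableD mA i1 iE).
rewrite [leRHS](_ : _ = c * expR (s * m + s ^+ 2 / 8)); last first.
  by rewrite -expRD addNr expR0.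
apply: (@le_trans _ _ (\int[P]_(x in A) (c * (1 + X x * (expR s - 1))))).
  apply: le_Rintegral => //.
  - apply: (@bounded_integrable _ (expR s)).
      apply: measurableT_comp; first exact: measurable_expR.
      apply: measurable_funB; last exact: measurable_cst.
      apply: measurable_funM; first exact: measurable_cst.
      by apply: measurable_funB => //; exact: measurable_cst.
    move=> x /X01 /andP[x0 x1]; rewrite ger0_norm ?expR_ge0// ler_expR.
    have /andP[m0 _] := m01.
    have : s * (X x - m) <= s * 1 by rewrite ler_wpM2l//; lra.
    by have := sqr_ge0 s; lra.
  - apply: (@bounded_integrable _ (c * (1 + `|expR s - 1|))).
      apply: measurable_funM; first exact: measurable_cst.
      apply: measurable_funD; first exact: measurable_cst.
      by apply: measurable_funM => //; exact: measurable_cst.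
    move=> x /X01 /andP[x0 x1]; rewrite normrM (ger0_norm c0) ler_wpM2l//.
    by rewrite (le_trans (ler_normD _ _))// normr1 lerD2l normrM (ger0_norm x0) ler_piMl.
  - move=> x /X01 x01; rewrite /c.
    have -> : s * (X x - m) - s ^+ 2 / 8 = - (s * m + s ^+ 2 / 8) + s * X x by ring.
    rewrite expRD ler_wpM2l ?expR_ge0// (le_trans (expR_chord s x01))//.
    by rewrite le_eqVlt; apply/orP; left; apply/eqP; ring.
rewrite RintegralZl// ler_wpM2l// RintegralD// RintegralZr// Rintegral_prob_cst.
rewrite -/m (le_trans _ (bernoulli_mgf_le m01 s0))//.
by rewrite le_eqVlt; apply/orP; left; apply/eqP; ring.
Qed.

End integrals.

(** * Submartingales along bid histories *)

Section histories.
Variables (R : realType) (vbar : R) (T : nat) (G : probability R R).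
Hypothesis GA : G `[0, vbar]%classic = 1%E.

Local Notation A := (`[0, vbar]%classic : set R).

Definition in_range (h : seq R) := all (fun q => 0 <= q <= vbar) h.

Lemma in_range_rcons h q : in_range (rcons h q) = (0 <= q <= vbar) && in_range h.
Proof. by rewrite /in_range all_rcons. Qed.

(* Only the next bid is integrated, so [W] need not be jointly measurable. *)
Definition submart (W : seq R -> R) := forall h, (size h < T)%N -> in_range h ->
  G.-integrable A (EFin \o (fun q => W (rcons h q))) /\
  W h <= \int[G]_(q in A) W (rcons h q).

Let mA : measurable A. Proof. exact: measurable_itv. Qed.

Lemma submartD W1 W2 : submart W1 -> submart W2 ->
  submart (fun h => W1 h + W2 h).
Proof.
move=> s1 s2 h hT hr; have [i1 le1] := s1 h hT hr; have [i2 le2] := s2 h hT hr.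
by split; [exact: (integrableD mA i1 i2)|rewrite RintegralD// lerD].
Qed.

Lemma submart_cst (r : R) : submart (fun=> r).
Proof.
move=> h _ _; split; last by rewrite Rintegral_prob_cst.
by apply: (@bounded_integrable _ _ _ _ _ mA GA _ `|r|) => //; exact: measurable_cst.
Qed.

Lemma submartZ (c : R) W : 0 <= c -> submart W -> submart (fun h => c * W h).
Proof.
move=> c0 sW h hT hr; have [i1 le1] := sW h hT hr.
by split; [exact: (integrableZl mA c i1)|rewrite RintegralZl// ler_wpM2l].
Qed.

Lemma submart_sum (I : Type) (r : seq I) (W : I -> seq R -> R) :
  (forall i, submart (W i)) -> submart (fun h => \sum_(i <- r) W i h).
Proof.
move=> sW; elim: r => [|i r IH].
  rewrite (_ : (fun h => _) = fun=> 0); first exact: submart_cst.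
  by apply/funext => h; rewrite big_nil.
rewrite (_ : (fun h => _) = fun h => W i h + \sum_(j <- r) W j h).
  exact: submartD.
by apply/funext => h; rewrite big_cons.
Qed.

(** Backward induction on the number of bids still to be drawn. The upper bound [K] is carried along
    because it keeps the inner iterated integrals finite. *)
Lemma iid_expect_ge (f W : seq R -> R) (K : R) : 0 <= K -> submart W ->
  (forall ps, size ps = T -> in_range ps -> W ps <= f ps <= K) ->
  W [::] <= iid_expect G T f.
Proof.
move=> K0 sW Wf.
suff H n : forall h, (size h + n = T)%N -> in_range h ->
    W h <= iid_expect G n (fun ps => f (h ++ ps)) <= K.
  by have /andP[] := H T [::] (add0n _) isT.
elim: n => [|n IH] h hn hr /=.
  by rewrite cats0; apply: Wf => //; rewrite addn0 in hn.
have hT : (size h < T)%N by rewrite -hn addnS ltnS leq_addr.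
have [iW leW] := sW h hT hr.
have {}IH q : A q -> W (rcons h q) <=
    iid_expect G n (fun ps => f (h ++ q :: ps)) <= K.
  rewrite /= in_itv/= => qr.
  under eq_fun do rewrite -cat_rcons.
  by apply: IH; rewrite ?in_range_rcons ?qr// size_rcons addSnnS.
have /andP[lo hi] := @Rintegral_sandwich _ _ _ G A _
  (fun q => iid_expect G n (fun ps => f (h ++ q :: ps))) K mA GA K0 iW
  (fun q Aq => proj1 (andP (IH q Aq))) (fun q Aq => proj2 (andP (IH q Aq))).
by rewrite hi andbT (le_trans leW).
Qed.

(** The first argument of [psi] is the strict past of the round, so factors depending on it alone
    are predictable. *)
Definition hist_sum (psi : seq R -> R -> R) (h : seq R) : R :=
  \sum_(i < size h) psi (take i h) (nth 0 h i).

Lemma hist_sum_nil psi : hist_sum psi [::] = 0.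
Proof. by rewrite /hist_sum big_ord0. Qed.

Lemma hist_sum_rcons psi h q :
  hist_sum psi (rcons h q) = hist_sum psi h + psi h q.
Proof.
rewrite /hist_sum size_rcons big_ord_recr /=; congr (_ + _).
  apply: eq_bigr => i _; rewrite nth_rcons ltn_ord -cats1 takel_cat//.
  exact: ltnW.
by rewrite nth_rcons ltnn eqxx -cats1 take_size_cat.
Qed.

Lemma submart_hist_sum (psi : seq R -> R -> R) :
  (forall h, (size h < T)%N -> in_range h ->
    G.-integrable A (EFin \o psi h) /\ \int[G]_(q in A) psi h q = 0) ->
  submart (hist_sum psi).
Proof.
move=> Hpsi h hT hr; have [ipsi psi0] := Hpsi h hT hr.
have [ic _] := submart_cst (hist_sum psi h) hT hr.
rewrite (_ : (fun q => _) = fun q => hist_sum psi h + psi h q); last first.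
  by apply/funext => q; rewrite hist_sum_rcons.
split; first exact: (integrableD mA ic ipsi).
by rewrite RintegralD// psi0 addr0 Rintegral_prob_cst.
Qed.

(** In the expanded square the cross term has mean zero, since the current sum is fixed by the past,
    and the new square has mean at most [M ^+ 2]. *)
Lemma submart_hist_sum_sqr (psi : seq R -> R -> R) (M : R) :
  (forall h, (size h < T)%N -> in_range h ->
    [/\ measurable_fun A (psi h), forall q, A q -> `|psi h q| <= M &
     \int[G]_(q in A) psi h q = 0]) ->
  submart (fun h => (size h)%:R * M ^+ 2 - (hist_sum psi h) ^+ 2).
Proof.
move=> Hpsi h hT hr; have [mpsi psiM psi0] := Hpsi h hT hr.
have ipsi := bounded_integrable mA GA mpsi psiM.
set S := hist_sum psi h.
pose c := (size h).+1%:R * M ^+ 2 - S ^+ 2 : R.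
have [ic _] := submart_cst c hT hr.
have i2 : G.-integrable A (EFin \o (fun q => (2 * S) * psi h q)).
  exact: (integrableZl mA (2 * S) ipsi).
have i3 : G.-integrable A (EFin \o (fun q => psi h q ^+ 2)).
  apply: (@bounded_integrable _ _ _ _ _ mA GA _ (M ^+ 2)).
    exact: measurable_funX.
  by move=> q /psiM qM; rewrite normrX lerXn2r ?nnegrE// (le_trans _ qM).
have i12 := integrableB mA ic i2.
rewrite (_ : (fun q => _) =
    fun q => c - 2 * S * psi h q - psi h q ^+ 2); last first.
  by apply/funext => q; rewrite size_rcons hist_sum_rcons -/S /c; ring.
split; first exact: (integrableB mA i12 i3).
rewrite RintegralB// RintegralB// RintegralZl// psi0 mulr0 subr0.
rewrite Rintegral_prob_cst//.
have : \int[G]_(q in A) (psi h q ^+ 2) <= M ^+ 2.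
  suff H q : A q -> 0 <= psi h q ^+ 2 <= M ^+ 2.
    by have /andP[] := Rintegral_bounds mA GA i3 H.
  move=> /psiM qM; rewrite sqr_ge0/= -[_ ^+ 2]ger0_norm ?sqr_ge0//.
  by rewrite normrX lerXn2r ?nnegrE// (le_trans _ qM).
by rewrite /c -natr1; lra.
Qed.

(** Each round multiplies the exponential by a factor of conditional mean at most 1; the sign turns
    this supermartingale into a [submart]. *)
Lemma submart_expR_hist_sum (theta : seq R -> R -> R) :
  (forall h, (size h < T)%N -> in_range h ->
    G.-integrable A (EFin \o (fun q => expR (theta h q))) /\
    \int[G]_(q in A) expR (theta h q) <= 1) ->
  submart (fun h => - expR (hist_sum theta h)).
Proof.
move=> Hth h hT hr; have [ith th1] := Hth h hT hr.
rewrite (_ : (fun q => _) =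
    fun q => - expR (hist_sum theta h) * expR (theta h q)); last first.
  by apply/funext => q; rewrite hist_sum_rcons expRD mulNr.
split; first exact: (integrableZl mA _ ith).
by rewrite RintegralZl// mulNr lerN2 -[leRHS]mulr1 ler_wpM2l.
Qed.

End histories.

(** * Telescoping square roots and algebra of history sums *)

Section sqrt_nat.
Variable R : realType.

Lemma sqrt_natS_sqr (n : nat) :
  Num.sqrt (n.+1%:R : R) ^+ 2 = Num.sqrt (n%:R : R) ^+ 2 + 1.
Proof. by rewrite !sqr_sqrtr// natr1. Qed.

(** The difference of the roots is the inverse of their sum. This version sums the gradient
    steps. *)
Lemma inv_sqrt_natS_le (n : nat) :
  (Num.sqrt (n.+1%:R : R))^-1 <= 2 * (Num.sqrt n.+1%:R - Num.sqrt n%:R).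
Proof.
have := sqrt_natS_sqr n; have : 0 < Num.sqrt (n.+1%:R : R) by rewrite sqrtr_gt0.
have : 0 <= Num.sqrt (n%:R : R) by exact: sqrtr_ge0.
move: (Num.sqrt n%:R) (Num.sqrt n.+1%:R) => a b a0 b0 ab.
by rewrite -[leLHS]mul1r ler_pdivrMr//; nra.
Qed.

(** This version sums the radii, which involve the number of observations before the bid. For
    [n = 0] the inverse is 0 by convention; otherwise the larger root is at most twice the
    smaller. *)
Lemma inv_sqrt_nat_le (n : nat) :
  (Num.sqrt (n%:R : R))^-1 <= 4 * (Num.sqrt n.+1%:R - Num.sqrt n%:R).
Proof.
case: n => [|n].
  by rewrite sqrtr0 invr0 subr0 mulr_ge0.
have := sqrt_natS_sqr n.+1.
have : 1 <= Num.sqrt (n.+1%:R : R) by rewrite -[leLHS]sqrtr1 ler_sqrt// ler1n.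
have : 0 <= Num.sqrt (n.+2%:R : R) by exact: sqrtr_ge0.
move: (Num.sqrt n.+1%:R) (Num.sqrt n.+2%:R) => a b b0 a1 ab.
have a0 : 0 < a by lra.
have b2 : b <= 2 * a by rewrite -(@ler_pXn2r _ 2)// ?nnegrE ?exprMn; nra.
by rewrite -[leLHS]mul1r ler_pdivrMr//; nra.
Qed.

End sqrt_nat.

Section hist_sum_theory.
Variables (R : realType) (vbar : R) (T : nat).
Implicit Types (psi : seq R -> R -> R) (h : seq R).

Lemma hist_sumD psi1 psi2 h : hist_sum (fun h q => psi1 h q + psi2 h q) h =
  hist_sum psi1 h + hist_sum psi2 h.
Proof. by rewrite /hist_sum big_split. Qed.

Lemma hist_sumZ c psi h : hist_sum (fun h q => c * psi h q) h =
  c * hist_sum psi h.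
Proof. by rewrite /hist_sum mulr_sumr. Qed.

Lemma le_hist_sum psi1 psi2 h : (size h <= T)%N -> in_range vbar h ->
  (forall g q, (size g < T)%N -> in_range vbar g -> 0 <= q <= vbar ->
    psi1 g q <= psi2 g q) ->
  hist_sum psi1 h <= hist_sum psi2 h.
Proof.
move=> hT hr le12; elim/last_ind: h hT hr => [|h q IH]; first by rewrite !hist_sum_nil.
rewrite size_rcons in_range_rcons !hist_sum_rcons => hT /andP[qr hr].
by apply: lerD; [apply: IH => //; exact: ltnW|exact: (le12 h q hT hr qr)].
Qed.

Lemma eq_hist_sum psi1 psi2 h : (forall g q, psi1 g q = psi2 g q) ->
  hist_sum psi1 h = hist_sum psi2 h.
Proof. by move=> e12; apply: eq_bigr => i _; rewrite e12. Qed.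

Lemma hist_sum_cst c h : hist_sum (fun _ _ => c) h = (size h)%:R * c.
Proof. by rewrite /hist_sum sumr_const card_ord mulr_natl. Qed.

Lemma ler_sum_in_range (s : seq R) (f : R -> R) (b : R) : in_range vbar s ->
  (forall q, 0 <= q <= vbar -> f q <= b) ->
  \sum_(q <- s) f q <= (size s)%:R * b.
Proof.
move=> + fb; elim: s => [|q s IH] /=; first by rewrite big_nil mul0r.
move=> /andP[qr sr]; rewrite big_cons -natr1 mulrDl mul1r addrC.
by rewrite lerD// ?fb// IH.
Qed.

End hist_sum_theory.

Section bid_bounds.
Variables (R : realType) (x q : R).
Hypothesis q0 : 0 <= q.

Lemma rew_bounds : 0 <= x -> 0 <= rew x q <= x.
Proof.
by move=> x0; rewrite /rew /pospart le_max lexx orbT ge_max x0 andbT lerBlDr lerDl.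
Qed.

Lemma cost_bounds : 0 <= x -> 0 <= cost x q <= x.
Proof. by move=> x0; rewrite /cost; case: ifPn => [->|]; rewrite ?q0 ?lexx. Qed.

End bid_bounds.

(** * OGD-CB along a bid history *)

Section ogd_history.
Variables (R : realType) (vbar rho : R) (T : nat) (v : nat -> R).
Implicit Types (h : seq R) (q : R).

(** A step reads the bid sequence only at its own round, so a constant sequence can be fed to each
    step and the state becomes a function of a finite list. *)
Definition hist_state h : ogd_state R :=
  foldl (fun s qt => ogd_step vbar rho T v (fun=> qt.1) s qt.2)
    (OGDState 0 [::] (rho * T%:R) 0 false) (zip h (iota 1 (size h))).

Lemma hist_state_rcons h q : hist_state (rcons h q) =
  ogd_step vbar rho T v (fun=> q) (hist_state h) (size h).+1.
Proof.
rewrite /hist_state size_rcons -[(size h).+1]addn1 iotaD /= cats1 add1n addn1.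
by rewrite zip_rcons ?size_iota// foldl_rcons.
Qed.

Lemma ogd_revenue_hist ps : size ps = T ->
  ogd_revenue vbar rho T v (bids_of ps) = st_rev (hist_state ps).
Proof.
move=> psT; rewrite /ogd_revenue; congr st_rev.
suff H k : (k <= size ps)%N ->
    foldl (ogd_step vbar rho T v (bids_of ps))
      (OGDState 0 [::] (rho * T%:R) 0 false) (iota 1 k) = hist_state (take k ps).
  by have := H _ (leqnn _); rewrite take_size psT.
elim: k => [|k IH] kps; first by rewrite take0.
rewrite (take_nth 0)// hist_state_rcons size_takel ?(ltnW kps)//.
by rewrite -{1}(addn1 k) iotaD /= cats1 foldl_rcons add1n (IH (ltnW kps)).
Qed.

Definition lam h := st_lam (hist_state h).
Definition obs h := st_obs (hist_state h).
Definition run h := ~~ st_stopped (hist_state h).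
Definition vnext h := v (size h).+1.
Definition radius h :=
  Num.sqrt ((ln 2 + 2 * ln T%:R) / (2 * (size (obs h))%:R)) : R.
Definition rtilde h :=
  (\sum_(q <- obs h) rew (vnext h) q) / (size (obs h))%:R + radius h * vnext h.
Definition ctilde h :=
  (\sum_(q <- obs h) cost (vnext h) q) / (size (obs h))%:R
  - 2 * radius h * vnext h.
Definition bid h := (size h == 0)%N || (lam h * ctilde h <= rtilde h).
Definition act h := run h && bid h.
(* The first round leaves the multiplier unchanged, hence a zero gradient. *)
Definition grad h : R :=
  if (size h == 0)%N then 0 else (if bid h then ctilde h else 0) - rho.

Lemma hist_state_nil : hist_state [::] = OGDState 0 [::] (rho * T%:R) 0 false.
Proof. by []. Qed.

Lemma ogd_step_hist h q : hist_state (rcons h q) =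
  if run h then
    let B' := if bid h then st_bud (hist_state h) - cost (vnext h) q
              else st_bud (hist_state h) in
    OGDState
      (Num.max (lam h + 1 / (vbar * Num.sqrt (size h).+1%:R) * grad h) 0)
      (if bid h then rcons (obs h) q else obs h) B'
      (st_rev (hist_state h) + (if bid h then rew (vnext h) q else 0))
      (B' < vbar)
  else hist_state h.
Proof.
rewrite hist_state_rcons /ogd_step /run; case: (st_stopped _) => //=.
have [h0|h0] := posnP (size h).
  have -> : h = [::] by exact: size0nil.
  by rewrite /bid /= /lam /obs /vnext hist_state_nil /= /grad /= mulr0 addr0 maxxx.
rewrite eqSS /grad /bid (gtn_eqF h0) /=.
by [].
Qed.

Lemma obs_sum (f : R -> R) h :
  \sum_(q <- obs h) f q = hist_sum (fun g q => (act g)%:R * f q) h.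
Proof.
elim/last_ind: h => [|h q IH]; first by rewrite hist_sum_nil big_nil.
rewrite hist_sum_rcons -IH /obs ogd_step_hist /act.
case: (run h); last by rewrite mul0r addr0.
by case: (bid h) => /=; rewrite ?mul0r ?addr0// mul1r big_rcons/=.
Qed.

Lemma bud_hist_sum h : st_bud (hist_state h) =
  rho * T%:R - hist_sum (fun g q => (act g)%:R * cost (vnext g) q) h.
Proof.
elim/last_ind: h => [|h q IH]; first by rewrite hist_sum_nil subr0.
rewrite hist_sum_rcons opprD addrA -IH ogd_step_hist /act.
case: (run h); last by rewrite mul0r subr0.
by case: (bid h) => /=; rewrite ?mul0r ?subr0// mul1r.
Qed.

Lemma rev_hist_sum h : st_rev (hist_state h) =
  hist_sum (fun g q => (act g)%:R * rew (vnext g) q) h.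
Proof.
elim/last_ind: h => [|h q IH]; first by rewrite hist_sum_nil.
rewrite hist_sum_rcons -IH ogd_step_hist /act.
case: (run h); last by rewrite mul0r addr0.
by case: (bid h) => /=; rewrite ?mul0r ?addr0// mul1r.
Qed.

(** The state is frozen after stopping, so the inequality that triggered the stop persists. *)
Lemma stopped_budget h : ~~ run h -> st_bud (hist_state h) < vbar.
Proof.
elim/last_ind: h => [//|h q IH]; rewrite /run ogd_step_hist -/(run _).
by case: ifPn => [_|/IH]/=; rewrite ?negbK.
Qed.

Lemma run_rcons h q : run (rcons h q) -> run h.
Proof. by rewrite {1}/run ogd_step_hist; case: ifPn => // /negPf; rewrite /run => ->. Qed.

(** Stopping is permanent: a process still running at the end ran in every round. *)
Lemma hist_sum_run (psi : seq R -> R -> R) h : run h ->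
  hist_sum (fun g q => (run g)%:R * psi g q) h = hist_sum psi h.
Proof.
elim/last_ind: h => [|h q IH]; first by rewrite !hist_sum_nil.
by move=> /run_rcons hrun; rewrite !hist_sum_rcons IH// hrun mul1r.
Qed.

Lemma obs_in_range h : in_range vbar h -> in_range vbar (obs h).
Proof.
elim/last_ind: h => [//|h q IH]; rewrite in_range_rcons => /andP[qr hr].
rewrite /obs ogd_step_hist; case: ifPn => _ /=; last exact: IH.
by case: ifPn => _; rewrite ?in_range_rcons ?qr IH.
Qed.

Lemma size_obs_rcons h q : size (obs (rcons h q)) = (act h + size (obs h))%N.
Proof.
rewrite /obs ogd_step_hist /act; case: ifPn => _ //=.
by case: ifPn => _; rewrite ?size_rcons.
Qed.

Lemma size_obs_le h : (size (obs h) <= size h)%N.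
Proof.
elim/last_ind: h => [//|h q IH]; rewrite size_obs_rcons size_rcons.
by case: (act h); rewrite ?ltnS// ltnW.
Qed.

(** The forced bid of the first round guarantees an observation, so later empirical means are
    genuine. *)
Lemma size_obs_gt0 h : (0 < size h)%N -> (0 < size (obs h))%N.
Proof.
elim/last_ind: h => [//|h q IH] _; rewrite size_obs_rcons.
have [h0|/IH h0] := posnP (size h); last by rewrite addn_gt0 h0 orbT.
by rewrite (size0nil h0).
Qed.

(** * Deterministic bounds: multiplier, regret, confidence and budget *)

Hypotheses (vbar_gt0 : 0 < vbar) (rho_gt0 : 0 < rho) (rho_le : rho <= vbar).
Hypothesis T_gt0 : (0 < T)%N.
Hypothesis v_range : forall t, (1 <= t <= T)%N -> 0 <= v t <= vbar.
Variables r c : R -> R.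
Hypothesis r_bounds : forall x, 0 <= x -> 0 <= r x <= x.
Hypothesis c_bounds : forall x, 0 <= x -> 0 <= c x <= x.

Definition ell : R := Num.sqrt ((ln 2 + 2 * ln T%:R) / 2).
(** Above [vbar * (1 + ell) / rho] the multiplier can no longer increase, and a single step raises
    it by at most 1. *)
Definition lam_max : R := vbar * (1 + ell) / rho + 1.

Lemma ln_sum_ge0 : 0 <= ln 2 + 2 * ln T%:R :> R.
Proof.
by rewrite addr_ge0 ?mulr_ge0// ?ln_ge0// ler1n.
Qed.

Lemma ell_ge0 : 0 <= ell. Proof. exact: sqrtr_ge0. Qed.

Lemma lam_max_ge1 : 1 <= lam_max.
Proof.
by rewrite lerDr divr_ge0 ?(ltW rho_gt0)// mulr_ge0 ?addr_ge0 ?ell_ge0// ltW.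
Qed.

Lemma vnext_range h : (size h < T)%N -> 0 <= vnext h <= vbar.
Proof. by move=> hT; apply: v_range. Qed.

Lemma radiusE h : radius h = ell * (Num.sqrt (size (obs h))%:R)^-1.
Proof.
rewrite /radius /ell invfM mulrA sqrtrM ?sqrtrV//.
by rewrite divr_ge0// ln_sum_ge0.
Qed.

Lemma radius_ge0 h : 0 <= radius h. Proof. exact: sqrtr_ge0. Qed.

Lemma radius_le h : radius h <= ell.
Proof.
rewrite radiusE ler_piMr ?ell_ge0//; case: (size _) => [|n].
  by rewrite sqrtr0 invr0.
by rewrite invf_le1 ?sqrtr_gt0// -[leLHS]sqrtr1 ler_sqrt// ler1n.
Qed.

Lemma mean_in_range (s : seq R) (f : R -> R) (x : R) : in_range vbar s ->
  0 <= x -> (forall q, 0 <= q -> 0 <= f q <= x) ->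
  0 <= (\sum_(q <- s) f q) / (size s)%:R <= x.
Proof.
move=> sr x0 f0x.
have h1 : \sum_(q <- s) f q <= (size s)%:R * x.
  by apply: (ler_sum_in_range sr) => q /andP[/f0x/andP[]].
have h0 : 0 <= \sum_(q <- s) f q.
  rewrite big_seq; apply: sumr_ge0 => q /(allP sr) /andP[q0 _].
  by have /andP[] := f0x q q0.
rewrite divr_ge0//=; have [->|n0] := posnP (size s); first by rewrite invr0 mulr0.
by rewrite ler_pdivrMr ?ltr0n// mulrC.
Qed.

Lemma mean_rew_range h : (size h < T)%N -> in_range vbar h ->
  0 <= (\sum_(q <- obs h) rew (vnext h) q) / (size (obs h))%:R <= vnext h.
Proof.
move=> hT hr; have /andP[x0 _] := vnext_range hT.
apply: mean_in_range => //; first exact: obs_in_range.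
by move=> q q0; exact: rew_bounds.
Qed.

Lemma mean_cost_range h : (size h < T)%N -> in_range vbar h ->
  0 <= (\sum_(q <- obs h) cost (vnext h) q) / (size (obs h))%:R <= vnext h.
Proof.
move=> hT hr; have /andP[x0 _] := vnext_range hT.
apply: mean_in_range => //; first exact: obs_in_range.
by move=> q q0; exact: cost_bounds.
Qed.

Lemma radius_vnext h : (size h < T)%N ->
  0 <= radius h * vnext h <= ell * vbar /\ radius h * vnext h <= radius h * vbar.
Proof.
move=> /vnext_range/andP[x0 xv]; have e0 := radius_ge0 h; have el := radius_le h.
by rewrite mulr_ge0// ler_pM// ler_wpM2l.
Qed.

Lemma rtilde_le h : (size h < T)%N -> in_range vbar h ->
  rtilde h <= vbar * (1 + ell).
Proof.
move=> hT hr; have /andP[_] := mean_rew_range hT hr.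
have /andP[_] := vnext_range hT; have [/andP[_]] := radius_vnext hT.
by rewrite /rtilde; lra.
Qed.

Lemma ctilde_range h : (size h < T)%N -> in_range vbar h ->
  [/\ ctilde h <= vbar, - (2 * radius h * vbar) <= ctilde h &
      - (2 * ell * vbar) <= ctilde h].
Proof.
move=> hT hr; have /andP[] := mean_cost_range hT hr.
have /andP[_] := vnext_range hT; have [/andP[]] := radius_vnext hT.
rewrite /ctilde -!mulrA.
by move: (radius h * vnext h) => u; split; lra.
Qed.

(** The one-sided bound, free of [ell], limits upward moves of the multiplier; the absolute bound
    enters the regret through squared gradients. *)
Lemma grad_range h : (size h < T)%N -> in_range vbar h ->
  grad h <= vbar /\ `|grad h| <= vbar * (1 + 2 * ell).
Proof.
move=> hT hr; have [c1 _ c2] := ctilde_range hT hr.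
have e0 : 0 <= vbar * ell by rewrite mulr_ge0 ?ell_ge0// ltW.
move: rho_gt0 rho_le vbar_gt0 => p1 p2 p3; rewrite ler_norml /grad.
case: ifPn => _; first by split; lra.
by case: ifPn => _; split; lra.
Qed.

Lemma lam_rcons h q : lam (rcons h q) =
  if run h then Num.max (lam h + 1 / (vbar * Num.sqrt (size h).+1%:R) * grad h) 0
  else lam h.
Proof. by rewrite /lam ogd_step_hist; case: ifPn. Qed.

Lemma eta_range (n : nat) : 0 < 1 / (vbar * Num.sqrt n.+1%:R) <= 1 / vbar.
Proof.
have s1 : 1 <= Num.sqrt (n.+1%:R : R) by rewrite -[leLHS]sqrtr1 ler_sqrt// ler1n.
rewrite divr_gt0 ?mulr_gt0 ?(lt_le_trans _ s1)//= ler_pM2l//.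
by rewrite lef_pV2 ?posrE ?mulr_gt0 ?(lt_le_trans _ s1)// ler_peMr// ltW.
Qed.

(* The multiplier increases only when [rho < ctilde], and a bid then forces
   [lam * rho <= rtilde]. *)
Lemma lam_range h : (size h <= T)%N -> in_range vbar h -> 0 <= lam h <= lam_max.
Proof.
elim/last_ind: h => [_ _|h q IH].
  by rewrite /lam /= lexx (le_trans ler01 lam_max_ge1).
rewrite size_rcons in_range_rcons => hT /andP[_ hr].
have {IH}/andP[l0 lm] := IH (ltnW hT) hr.
rewrite lam_rcons; case: (run h); last by rewrite l0.
rewrite le_max lexx orbT /= ge_max (le_trans ler01 lam_max_ge1) andbT.
have /andP[] := eta_range (size h).
move: (1 / _) => eta e0 eV.
have [g0|g0] := leP (grad h) 0.
  by rewrite (le_trans _ lm)// gerDl mulr_ge0_le0// ltW.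
have [g1 _] := grad_range hT hr.
have eg : eta * grad h <= 1.
  have -> : 1 = 1 / vbar * vbar by rewrite mulfVK// gt_eqF.
  by rewrite ler_pM// ltW.
rewrite /lam_max lerD// ler_pdivlMr// (le_trans _ (rtilde_le hT hr))//.
move: g0; rewrite /grad; case: ifPn => [_|h0]; first by rewrite ltxx.
rewrite /bid (negbTE h0) /=; case: ifPn => [b|_]; last first.
  by move: rho_gt0; lra.
rewrite subr_gt0 => /ltW cr; apply: le_trans b.
by rewrite ler_wpM2l.
Qed.

(** Online gradient analysis with potential [(lam - theta) ^+ 2] weighted by the inverse of twice
    the step size. Subtracting [lam_max ^+ 2] makes the bracket nonpositive, so the growing weights
    telescope; the squared gradients sum by the telescoping of inverse square roots. *)
Lemma regret_ge (theta : R) h : 0 <= theta <= 1 ->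
  (size h <= T)%N -> in_range vbar h ->
  vbar * Num.sqrt (size h)%:R / 2 * ((lam h - theta) ^+ 2 - lam_max ^+ 2)
   - vbar * (1 + 2 * ell) ^+ 2 * Num.sqrt (size h)%:R
  <= hist_sum (fun g _ => (run g)%:R * ((lam g - theta) * grad g)) h.
Proof.
move=> /andP[th0 th1].
elim/last_ind: h => [_ _|h q IH].
  by rewrite hist_sum_nil /= sqrtr0 !(mulr0, mul0r) subr0.
rewrite size_rcons in_range_rcons hist_sum_rcons => hT /andP[_ hr].
have {}IH := IH (ltnW hT) hr.
apply: le_trans (lerD IH (lexx _)).
have /andP[l0 lm] := lam_range (ltnW hT) hr.
have lm1 := lam_max_ge1.
have [_ gG] := grad_range hT hr.
(* Both [lam h] and [theta] lie in the interval from 0 to [lam_max]. *)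
have D0 : (lam h - theta) ^+ 2 - lam_max ^+ 2 <= 0.
  by rewrite subr_le0 -[leLHS]real_normK ?num_real// lerXn2r ?nnegrE//; [lra|];
    rewrite ler_norml; apply/andP; split; lra.
have sb := inv_sqrt_natS_le R (size h).
have s0 := sqrtr_ge0 ((size h)%:R : R).
have s1 : 0 < Num.sqrt ((size h).+1%:R : R) by rewrite sqrtr_gt0.
have ss : Num.sqrt ((size h)%:R : R) <= Num.sqrt (size h).+1%:R.
  by rewrite ler_sqrt// ler_nat.
rewrite lam_rcons.
move: (Num.sqrt (size h)%:R) (Num.sqrt (size h).+1%:R) s0 s1 ss sb => a b a0 b0 ab bV.
have G0 : 0 <= vbar * (1 + 2 * ell) ^+ 2 by rewrite mulr_ge0 ?sqr_ge0// ltW.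
have mono : vbar * b / 2 * ((lam h - theta) ^+ 2 - lam_max ^+ 2) <=
    vbar * a / 2 * ((lam h - theta) ^+ 2 - lam_max ^+ 2).
  by rewrite ler_wnM2r// ler_wpM2r// ler_wpM2l// ltW.
case: (run h); last first.
  rewrite mul0r addr0 lerD// lerN2 ler_wpM2l//.
rewrite [true%:R * _]mul1r.
set g := grad h in gG *; set eta := 1 / (vbar * b).
have e0 : 0 < eta by rewrite divr_gt0// mulr_gt0.
(* Projection onto the nonnegative reals does not move away from [theta]. *)
have proj : (Num.max (lam h + eta * g) 0 - theta) ^+ 2 <=
    (lam h + eta * g - theta) ^+ 2.
  have [u0|_] := leP (lam h + eta * g) 0; last by [].
  by move: u0 th0; move: (lam h + eta * g) => u u0 t0; nra.
have eb : vbar * b / 2 * (2 * eta) = 1.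
  by rewrite /eta; field; rewrite !gt_eqF.
have w0 : 0 <= vbar * b / 2 by rewrite divr_ge0// mulr_ge0// ltW.
have step : vbar * b / 2 * (Num.max (lam h + eta * g) 0 - theta) ^+ 2 <=
    vbar * b / 2 * (lam h - theta) ^+ 2 + (lam h - theta) * g + eta / 2 * g ^+ 2.
  apply: le_trans (ler_wpM2l w0 proj) _.
  rewrite le_eqVlt; apply/orP; left; apply/eqP.
  transitivity (vbar * b / 2 * (lam h - theta) ^+ 2 +
    (vbar * b / 2 * (2 * eta)) * ((lam h - theta) * g) +
    (vbar * b / 2 * (2 * eta)) * (eta / 2 * g ^+ 2)); first by field.
  by rewrite eb !mul1r.
have err : eta / 2 * g ^+ 2 <= vbar * (1 + 2 * ell) ^+ 2 * (b - a).
  have g2 : g ^+ 2 <= (vbar * (1 + 2 * ell)) ^+ 2.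
    rewrite -[leLHS]real_normK ?num_real// lerXn2r ?nnegrE//.
    by rewrite mulr_ge0 ?addr_ge0 ?mulr_ge0 ?ell_ge0// ltW.
  apply: (@le_trans _ _ (eta / 2 * (vbar * (1 + 2 * ell)) ^+ 2)).
    by rewrite ler_wpM2l// divr_ge0// ltW.
  have -> : eta / 2 * (vbar * (1 + 2 * ell)) ^+ 2 =
      vbar * (1 + 2 * ell) ^+ 2 * (b^-1 / 2).
    by rewrite /eta; field; rewrite !gt_eqF.
  by rewrite ler_wpM2l//; lra.
move: step err mono; move: (eta / 2 * g ^+ 2) ((lam h - theta) * g) => E Z.
move: ((Num.max _ _ - theta) ^+ 2) ((lam h - theta) ^+ 2) => X Y.
move: (vbar * b / 2) (vbar * a / 2) (lam_max ^+ 2) => W V L.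
move: (vbar * _ ^+ 2) => Q; lra.
Qed.

(** The telescoping runs over the number of observations, which advances exactly in the rounds that
    pay a radius. *)
Lemma radius_sum_le h :
  hist_sum (fun g _ => (act g)%:R * radius g) h <=
  4 * ell * Num.sqrt (size (obs h))%:R.
Proof.
elim/last_ind: h => [|h q IH]; first by rewrite hist_sum_nil mulr_ge0// mulr_ge0// ell_ge0.
rewrite hist_sum_rcons size_obs_rcons; case: (act h); last first.
  by rewrite mul0r addr0.
rewrite mul1r add1n radiusE.
have := ler_wpM2l ell_ge0 (inv_sqrt_nat_le R (size (obs h))).
move: IH; move: (Num.sqrt (size (obs h)).+1%:R) (Num.sqrt _) => a b.
move: (hist_sum _ _) => s; lra.
Qed.

(* [stat true] is the reward and [stat false] the cost; in [dev j], [j.1] selects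
   the statistic and [j.2] the tail of its deviation from the mean. *)
Definition stat (j : bool) (x q : R) := if j then rew x q else cost x q.
Definition mean (j : bool) (x : R) := if j then r x else c x.
Definition dev (j : bool * bool) h : R :=
  (-1) ^+ j.2 * \sum_(q <- obs h) (stat j.1 (vnext h) q - mean j.1 (vnext h)).
(** The first round has no estimates and counts as bad. *)
Definition bad h := (size h == 0)%N ||
  [exists j, (size (obs h))%:R * (radius h * vnext h) < dev j h].

(** Empirical means are within one scaled radius of the true means; the shifts by [+1] radius for
    the reward and [-2] radii for the cost make both estimates optimistic. *)
Lemma good_estimates h : ~~ bad h ->
  [/\ r (vnext h) <= rtilde h, rtilde h <= r (vnext h) + 2 * (radius h * vnext h),
      c (vnext h) - 3 * (radius h * vnext h) <= ctilde h &
      ctilde h <= c (vnext h)].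
Proof.
rewrite negb_or -lt0n => /andP[h0 /existsPn good].
have n0 := size_obs_gt0 h0.
have est (j : bool * bool) : (-1) ^+ j.2 *
    ((\sum_(q <- obs h) stat j.1 (vnext h) q) / (size (obs h))%:R - mean j.1 (vnext h))
    <= radius h * vnext h.
  rewrite -(@ler_pM2l _ (size (obs h))%:R) ?ltr0n//.
  have := good j; rewrite -leNgt; apply: le_trans.
  rewrite /dev sumrB big_const_seq count_predT iter_addr_0 -[mean _ _ *+ _]mulr_natl.
  rewrite le_eqVlt; apply/orP; left; apply/eqP; field.
  by rewrite pnatr_eq0 -lt0n.
have := est (true, true); have := est (true, false).
have := est (false, true); have := est (false, false).
rewrite /stat /mean /= !expr0 !expr1 /rtilde /ctilde -!mulrA.
move: (radius h * vnext h) => e.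
by split; lra.
Qed.

Lemma mean_ratio_le x : 0 <= x <= vbar ->
  [/\ 0 <= r x, 0 <= c x, c x <= vbar,
      rho / vbar * r x <= rho & rho / vbar * c x <= rho].
Proof.
move=> /andP[x0 xv].
have /andP[r0 rx] := r_bounds x0; have /andP[c0 cx] := c_bounds x0.
have k0 : 0 <= rho / vbar by rewrite divr_ge0// ltW.
have kv : rho / vbar * vbar = rho by rewrite divfK// gt_eqF.
by split => //; rewrite ?(le_trans cx)// -[leRHS]kv ler_wpM2l//;
  [exact: le_trans rx xv|exact: le_trans cx xv].
Qed.

(* Bidding with probability [rho / vbar] is a budget-feasible comparator: its
   cost per round is at most [rho]. *)
Lemma round_gain h : (size h < T)%N -> in_range vbar h ->
  rho / vbar * ((run h)%:R * r (vnext h)) + ((run h)%:R * (lam h * grad h) +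
   (- (2 * vbar) * ((act h)%:R * radius h) +
    - (vbar * (1 + lam_max)) * (bad h)%:R)) <= (act h)%:R * r (vnext h).
Proof.
move=> hT hr; have xr := vnext_range hT.
have [r0 c0 cv kr kc] := mean_ratio_le xr.
have /andP[l0 lm] := lam_range (ltnW hT) hr.
have [_ ex] := radius_vnext hT; have e0 := radius_ge0 h.
have lm1 := lam_max_ge1.
have k0 : 0 <= rho / vbar by rewrite divr_ge0// ltW.
have k1 : rho / vbar <= 1 by rewrite ler_pdivrMr// mul1r.
have ev : 0 <= radius h * vbar by rewrite mulr_ge0// ltW.
rewrite /act; case: (run h); last first.
  rewrite /= !mul0r mulr0 !add0r mulr0 add0r mulNr oppr_le0.
  rewrite mulr_ge0//; apply: mulr_ge0; [exact: ltW|by lra].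
rewrite /= !mul1r.
(* A bad round is settled by crude range bounds, paid for by the term [vbar * (1 + lam_max)]. *)
have [bd|gd] := boolP (bad h).
  have [g1 _] := grad_range hT hr.
  have lg : lam h * grad h <= lam_max * vbar.
    apply: (@le_trans _ _ (lam h * vbar)); first by rewrite ler_wpM2l.
    by rewrite ler_wpM2r// ltW.
  have kr1 : rho / vbar * r (vnext h) <= vbar by apply: le_trans kr _.
  rewrite mulr1; case: (bid h); rewrite ?mul1r ?mul0r ?mulr0.
    by have : 0 <= r (vnext h) by []; lra.
  by lra.
have h0 : (size h == 0)%N = false by move: gd; rewrite negb_or => /andP[/negbTE].
have [r1 r2 c1 c2] := good_estimates gd.
rewrite mulr0 addr0 /grad /bid h0 /=.
set x := vnext h in r0 c0 cv kr kc ex r1 r2 c1 c2 *.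
have lk : lam h * (rho / vbar * c x) <= lam h * rho by rewrite ler_wpM2l.
have lc : lam h * ctilde h <= lam h * c x by rewrite ler_wpM2l.
(* Without a bid, optimism gives [r <= rtilde < lam * ctilde <= lam * c]; scaled by [rho / vbar],
   the right end is at most [lam * rho]. *)
case: ifPn => [b|]; last first.
  rewrite -ltNge => b; rewrite !mul0r mulr0 addr0 sub0r mulrN subr_le0.
  apply: le_trans lk; rewrite mulrCA ler_wpM2l//.
  by rewrite (le_trans r1)// (le_trans (ltW b)).
rewrite !mul1r mulrBr mulNr.
suff : rho / vbar * (r x - lam h * c x) <= rtilde h - lam h * ctilde h.
  rewrite mulrBr [rho / vbar * (lam h * _)]mulrCA; lra.
(* Scaling by [rho / vbar <= 1] only lowers a nonnegative true gain; a negative one stays below 0,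
   hence below the optimistic gain, which the bid makes nonnegative. *)
have [s|s] := leP 0 (r x - lam h * c x).
  by apply: (@le_trans _ _ (r x - lam h * c x)); [rewrite ler_piMl|lra].
apply: (@le_trans _ _ 0); last by rewrite subr_ge0.
by rewrite mulr_ge0_le0// ltW.
Qed.

(** Relates the gradient to the true mean cost: the estimate falls short of it by at most three
    radii in a good round. This feeds the comparison with [theta = 1]. *)
Lemma round_budget h : (size h < T)%N -> in_range vbar h ->
  (act h)%:R * c (vnext h) + (- (3 * vbar) * ((act h)%:R * radius h) +
   (- rho * (run h)%:R + - vbar * (bad h)%:R)) <= (run h)%:R * grad h.
Proof.
move=> hT hr; have xr := vnext_range hT.
have [r0 c0 cv kr kc] := mean_ratio_le xr.
have [_ ex] := radius_vnext hT; have e0 := radius_ge0 h.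
have ev : 0 <= radius h * vbar by rewrite mulr_ge0// ltW.
rewrite /act; case: (run h); last first.
  rewrite /= !mul0r !mulr0 !add0r mulNr oppr_le0.
  by rewrite mulr_ge0// ltW.
rewrite /= !mul1r !mulr1 /grad.
have [h0|h0] := boolP (size h == 0)%N.
  by rewrite /bad /bid h0 /= !mul1r mulr1; move: rho_gt0 vbar_gt0; lra.
have [_ c2 _] := ctilde_range hT hr.
have [bd|gd] := boolP (bad h).
  by rewrite mulr1; case: (bid h); rewrite ?mul1r ?mul0r; move: vbar_gt0; lra.
have [_ _ c3 _] := good_estimates gd.
by rewrite mulr0; case: (bid h); rewrite ?mul1r ?mul0r; lra.
Qed.

Lemma hindsight_le ps : size ps = T ->
  hindsight rho T v (bids_of ps) <= hist_sum (fun g q => rew (vnext g) q) ps.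
Proof.
move=> psT.
have -> : hist_sum (fun g q => rew (vnext g) q) ps =
    \sum_(i < T) rew (v i.+1) (bids_of ps i.+1).
  rewrite -(big_mkord xpredT (fun i => rew (v i.+1) (bids_of ps i.+1))) -psT.
  rewrite big_mkord; apply: eq_bigr => i _.
  by rewrite /vnext size_takel// ltnW.
have rew0 i : 0 <= rew (v i.+1) (bids_of ps i.+1).
  by rewrite /rew /pospart le_max lexx orbT.
apply: bigmax_le => [|x _]; first exact: sumr_ge0.
by apply: ler_sum => i _; case: (x i); rewrite ?mul1r ?mul0r.
Qed.

(* If the budget runs out, comparing with the multiplier [theta = 1] instead of
   [theta = 0] recovers [rho] for each missed round, which dominates the
   comparator's reward [rho / vbar * r] there. *)
Lemma revenue_path (K : R) h : 0 < K -> size h = T -> in_range vbar h ->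
  hist_sum (fun g q => ((act g)%:R - rho / vbar) *
                       (rew (vnext g) q - r (vnext g))) h
  - hist_sum (fun g q => (act g)%:R * (cost (vnext g) q - c (vnext g))) h ^+ 2
      / (2 * K)
  - vbar * (2 + lam_max) * hist_sum (fun g _ => (bad g)%:R) h
  - (K / 2 + vbar + vbar * Num.sqrt T%:R *
      (20 * ell + lam_max ^+ 2 / 2 + (1 + 2 * ell) ^+ 2))
  <= hist_sum (fun g q => (act g)%:R * rew (vnext g) q) h
     - rho / vbar * hist_sum (fun g q => rew (vnext g) q) h.
Proof.
move=> K0 hT hr; have hTle : (size h <= T)%N by rewrite hT.
set N1 := hist_sum (fun g q => (_ - _) * _) h.
set N2 := hist_sum (fun g q => _ * (_ - _)) h.
set RW := hist_sum (fun g q => _ * rew _ _) h.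
set RA := hist_sum (fun g q => rew _ _) h.
set BD := hist_sum (fun g _ => (bad g)%:R) h.
set k := rho / vbar.
pose AR := hist_sum (fun g _ => (act g)%:R * r (vnext g)) h.
pose AC := hist_sum (fun g _ => (act g)%:R * c (vnext g)) h.
pose ACO := hist_sum (fun g q => (act g)%:R * cost (vnext g) q) h.
pose RR := hist_sum (fun g _ => (run g)%:R * r (vnext g)) h.
pose MR := hist_sum (fun g _ => r (vnext g)) h.
pose LG := hist_sum (fun g _ => (run g)%:R * (lam g * grad g)) h.
pose GG := hist_sum (fun g _ => (run g)%:R * grad g) h.
pose RD := hist_sum (fun g _ => (act g)%:R * radius g) h.
pose RN := hist_sum (fun g _ => (run g)%:R : R) h.
have N1E : N1 = RW - AR - k * RA + k * MR.
  rewrite /N1 (@eq_hist_sum _ _ (fun g q => (act g)%:R * rew (vnext g) q +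
    (-1 * ((act g)%:R * r (vnext g)) + (- k * rew (vnext g) q + k * r (vnext g))))).
    by rewrite !hist_sumD !hist_sumZ -/RW -/AR -/RA -/MR; ring.
  by move=> g q; rewrite /k; ring.
have N2E : N2 = ACO - AC.
  rewrite /N2 (@eq_hist_sum _ _ (fun g q => (act g)%:R * cost (vnext g) q +
    -1 * ((act g)%:R * c (vnext g)))).
    by rewrite hist_sumD hist_sumZ -/ACO -/AC; ring.
  by move=> g q; ring.
have gain : k * RR + (LG + (- (2 * vbar) * RD + - (vbar * (1 + lam_max)) * BD)) <= AR.
  rewrite -!hist_sumZ -!hist_sumD; apply: (le_hist_sum hTle hr) => g q gT gr _.
  exact: round_gain.
have RDle : RD <= 4 * ell * Num.sqrt T%:R.
  apply: le_trans (radius_sum_le h) _.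
  by rewrite ler_wpM2l ?mulr_ge0 ?ell_ge0// ler_sqrt// ler_nat -hT size_obs_le.
have BD0 : 0 <= BD by apply: sumr_ge0 => i _; exact: ler0n.
(* The final potential is nonnegative and is dropped. *)
have RG (theta : R) : 0 <= theta <= 1 ->
    - (vbar * Num.sqrt T%:R * (lam_max ^+ 2 / 2 + (1 + 2 * ell) ^+ 2)) <=
    LG - theta * GG.
  move=> th; have := regret_ge th hTle hr.
  rewrite (@eq_hist_sum _ _ (fun g _ => (run g)%:R * (lam g * grad g) +
    - theta * ((run g)%:R * grad g))); last by move=> g q; ring.
  rewrite hist_sumD hist_sumZ -/LG -/GG hT.
  have : 0 <= vbar * Num.sqrt T%:R / 2 * (lam h - theta) ^+ 2.
    by rewrite mulr_ge0 ?sqr_ge0// divr_ge0// mulr_ge0 ?sqrtr_ge0// ltW.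
  by move: (Num.sqrt T%:R) => s; lra.
(* Young's inequality trades the cost martingale for its square, whose mean is controlled by the
   compensator. *)
have N2K : N2 <= N2 ^+ 2 / (2 * K) + K / 2.
  have -> : N2 ^+ 2 / (2 * K) + K / 2 = N2 + (N2 - K) ^+ 2 / (2 * K).
    by field; rewrite gt_eqF.
  by rewrite lerDl divr_ge0 ?sqr_ge0// mulr_ge0// ltW.
have N2K0 : 0 <= N2 ^+ 2 / (2 * K) by rewrite divr_ge0 ?sqr_ge0// mulr_ge0// ltW.
have vRD : vbar * RD <= vbar * (4 * ell * Num.sqrt T%:R) by rewrite ler_wpM2l// ltW.
have vBD : 0 <= vbar * BD by rewrite mulr_ge0// ltW.
have vS : 0 <= vbar * (4 * ell * Num.sqrt T%:R).
  by rewrite !mulr_ge0 ?ell_ge0 ?sqrtr_ge0// ltW.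
have [hrun|hstop] := boolP (run h).
  have RRE : RR = MR by exact: hist_sum_run.
  have := RG 0; rewrite lexx ler01 => /(_ isT).
  move: gain; rewrite N1E RRE; move: (N2 ^+ 2 / _) N2K0 => n2 n20.
  move: vbar_gt0 K0 vRD vBD vS; lra.
have := RG 1; rewrite lexx ler01 => /(_ isT).
have : AC + (- (3 * vbar) * RD + (- rho * RN + - vbar * BD)) <= GG.
  rewrite -!hist_sumZ -!hist_sumD; apply: (le_hist_sum hTle hr) => g q gT gr _.
  exact: round_budget.
have : k * MR <= k * RR + (T%:R * rho + - rho * RN).
  have -> : T%:R * rho = hist_sum (fun _ _ => rho) h by rewrite hist_sum_cst hT.
  rewrite -!hist_sumZ -!hist_sumD; apply: (le_hist_sum hTle hr) => g q gT gr _.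
  have [r0 _ _ kr _] := mean_ratio_le (vnext_range gT).
  by rewrite /k; case: (run g); rewrite ?mulr1 ?mul1r ?mulr0 ?mul0r; lra.
(* Less than [vbar] is left, so the realized spending exceeds [rho * T - vbar]. *)
have := stopped_budget hstop; rewrite bud_hist_sum -/ACO.
move: gain N2K; rewrite N1E N2E; move: ((ACO - AC) ^+ 2 / _) => n2.
by move: vbar_gt0 K0 vRD vBD vS; lra.
Qed.

End ogd_history.

(** Lets a process frozen at round [t] be evaluated on a full-length history. *)
Lemma hist_sum_cutoff (R : realType) (psi : seq R -> R -> R) (t : nat) (h : seq R) :
  hist_sum (fun g q => if (size g < t)%N then psi g q else 0) h =
  hist_sum psi (take t h).
Proof.
elim/last_ind: h => [|h q IH]; first by rewrite !hist_sum_nil.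
rewrite hist_sum_rcons IH; case: ltnP => ht.
  by rewrite !take_oversize ?size_rcons// ?hist_sum_rcons// ltnW.
by rewrite addr0 -cats1 takel_cat.
Qed.

(** * Concentration and expectation *)

Section deviations.
Variables (R : realType) (vbar rho : R) (T : nat) (v : nat -> R).
Hypotheses (vbar_gt0 : 0 < vbar) (rho_gt0 : 0 < rho) (rho_le : rho <= vbar).
Hypothesis T_gt0 : (0 < T)%N.
Hypothesis v_range : forall t, (1 <= t <= T)%N -> 0 <= v t <= vbar.
Variable G : probability R R.
Hypothesis GA : G `[0, vbar]%classic = 1%E.

Local Notation A := (`[0, vbar]%classic : set R).

Let mA : measurable A. Proof. exact: measurable_itv. Qed.

Definition mean_rew (x : R) : R := \int[G]_(q in A) rew x q.
Definition mean_cost (x : R) : R := \int[G]_(q in A) cost x q.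

Local Notation act := (act vbar rho T v).
Local Notation obs := (obs vbar rho T v).
Local Notation bad_round := (bad vbar rho T v mean_rew mean_cost).
Local Notation mean := (mean mean_rew mean_cost).

Lemma measurable_rew (x : R) : measurable_fun A (rew x).
Proof.
apply: measurable_maxr; last exact: measurable_cst.
by apply: measurable_funB; [exact: measurable_cst|exact: measurable_id].
Qed.

Lemma measurable_cost (x : R) : measurable_fun A (cost x).
Proof.
apply: measurable_funTS.
apply: measurable_fun_ifT; [|exact: measurable_id|exact: measurable_cst].
by apply: measurable_fun_ler; [exact: measurable_id|exact: measurable_cst].
Qed.

Lemma measurable_stat j (x : R) : measurable_fun A (stat j x).
Proof. by case: j; [exact: measurable_rew|exact: measurable_cost]. Qed.

Lemma stat_bounds j (x q : R) : 0 <= q -> 0 <= x -> 0 <= stat j x q <= x.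
Proof. by case: j => q0 x0; [exact: rew_bounds|exact: cost_bounds]. Qed.

Lemma A_ge0 (q : R) : A q -> 0 <= q.
Proof. by rewrite /= in_itv/= => /andP[]. Qed.

Lemma integrable_stat j (x : R) : 0 <= x -> G.-integrable A (EFin \o stat j x).
Proof.
move=> x0; apply: (bounded_integrable mA GA (measurable_stat j x) (M := x)).
by move=> q /A_ge0 q0; have /andP[? ?] := stat_bounds j q0 x0; rewrite ger0_norm.
Qed.

Lemma meanE j x : mean j x = \int[G]_(q in A) stat j x q.
Proof. by case: j. Qed.

Lemma mean_bounds j x : 0 <= x -> 0 <= mean j x <= x.
Proof.
move=> x0; rewrite meanE; apply: (Rintegral_bounds mA GA (integrable_stat j x0)).
by move=> q /A_ge0 q0; exact: stat_bounds.
Qed.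

(** Hoeffding exponent with [s = 4 * e], so [s ^+ 2 / 8 = 2 * e ^+ 2], for the signed deviation
    rescaled by [x]. This tilt is optimal for [n] deviations of total size [n * e * x]: the exponent
    is then [2 * n * e ^+ 2]. *)
Definition tilt (e x : R) (j : bool * bool) (q : R) : R :=
  4 * e * ((-1) ^+ j.2 * (stat j.1 x q - mean j.1 x) / x) - 2 * e ^+ 2.

Lemma tilt_mgf (e x : R) j : 0 <= e -> 0 <= x ->
  G.-integrable A (EFin \o (fun q => expR (tilt e x j q))) /\
  \int[G]_(q in A) expR (tilt e x j q) <= 1.
Proof.
move=> e0 x0.
(* Reflecting the statistic for the opposite tail keeps its range between 0 and 1. *)
pose Y q := if j.2 then 1 - stat j.1 x q / x else stat j.1 x q / x.
have ms : measurable_fun A (fun q => stat j.1 x q / x).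
  by apply: measurable_funM; [exact: measurable_stat|exact: measurable_cst].
have mY : measurable_fun A Y.
  rewrite /Y; case: (j.2) => //.
  by apply: measurable_funB => //; exact: measurable_cst.
have s01 q : A q -> 0 <= stat j.1 x q / x <= 1.
  move=> /A_ge0 q0; have /andP[b0 b1] := stat_bounds j.1 q0 x0.
  rewrite divr_ge0//=; have [<-|x1] := eqVneq 0 x; first by rewrite invr0 mulr0.
  by rewrite ler_pdivrMr ?mul1r// lt_def eq_sym x1.
have Y01 q : A q -> 0 <= Y q <= 1.
  by move=> /s01; rewrite /Y; case: (j.2) => //; lra.
have isx : G.-integrable A (EFin \o (fun q => stat j.1 x q / x)).
  apply: (bounded_integrable mA GA ms (M := 1)) => q /s01/andP[? ?].
  by rewrite ger0_norm.
have EY : \int[G]_(q in A) Y q =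
    if j.2 then 1 - mean j.1 x / x else mean j.1 x / x.
  rewrite meanE -RintegralZr//; last exact: integrable_stat.
  rewrite /Y; case: (j.2) => //; rewrite RintegralB// ?Rintegral_prob_cst//.
  by apply: (bounded_integrable mA GA (M := 1)) => [|q _ /=];
    [exact: measurable_cst|rewrite normr1].
have tE q : tilt e x j q =
    4 * e * (Y q - \int[G]_(y in A) Y y) - (4 * e) ^+ 2 / 8.
  by rewrite EY /tilt /Y; case: (j.2); move: (x^-1) => y /=; field.
have -> : (fun q => expR (tilt e x j q)) =
    (fun q => expR (4 * e * (Y q - \int[G]_(y in A) Y y) - (4 * e) ^+ 2 / 8)).
  by apply/funext => q; rewrite tE.
have e4 : 0 <= 4 * e by rewrite mulr_ge0.
split; last exact: (Hoeffding_lemma mA GA mY Y01 e4).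
have /andP[m0 m1] : 0 <= \int[G]_(y in A) Y y <= 1.
  apply: (Rintegral_bounds mA GA _ Y01).
  apply: (bounded_integrable mA GA mY (M := 1)) => q /Y01/andP[? ?].
  by rewrite ger0_norm.
apply: (bounded_integrable mA GA (M := expR (4 * e))).
  apply: measurableT_comp; first exact: measurable_expR.
  apply: measurable_funB; last exact: measurable_cst.
  apply: measurable_funM; first exact: measurable_cst.
  by apply: measurable_funB => //; exact: measurable_cst.
move=> q /Y01/andP[y0 y1]; rewrite ger0_norm ?expR_ge0// ler_expR.
have : 4 * e * (Y q - \int[G]_(y in A) Y y) <= 4 * e * 1 by rewrite ler_wpM2l//; lra.
by have := sqr_ge0 (4 * e); lra.
Qed.

(* The index (t, (j, n)) stands for round [t + 1], the tail [j] and the event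
   that [n + 1] bids have been observed before that round. *)
Definition tail_mgf (i : 'I_T * ((bool * bool) * 'I_T)) (h : seq R) : R :=
  expR (hist_sum (fun g q => if (size g < i.1)%N then
    (act g)%:R * tilt (ell R T / Num.sqrt i.2.2.+1%:R) (v i.1.+1) i.2.1 q else 0) h).

Lemma submart_tail_mgf i : submart vbar T G (fun h => - tail_mgf i h).
Proof.
apply: submart_expR_hist_sum => // g gT gr.
have one : G.-integrable A (EFin \o (fun _ : R => expR 0)) /\
    \int[G]_(q in A) expR 0 <= 1 :> R.
  rewrite expR0 Rintegral_prob_cst//; split => //.
  by apply: (bounded_integrable mA GA (M := 1)) => [|q _ /=];
    [exact: measurable_cst|rewrite normr1].
case: ltnP => [gi|_]; last exact: one.
set e := _ / _; set x := v _.
have -> : (fun q => expR ((act g)%:R * tilt e x i.2.1 q)) =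
    if act g then fun q => expR (tilt e x i.2.1 q) else fun=> expR 0.
  by apply/funext => q; case: (act g); rewrite ?mul1r ?mul0r.
case: (act g); last exact: one.
apply: tilt_mgf; first by rewrite divr_ge0 ?sqrtr_ge0.
by have /andP[] := @v_range i.1.+1 (ltn_ord i.1).
Qed.

(** A pathwise Markov inequality: in a bad round after the first, the exponential matching the
    violated tail and the actual number of observations is at least [2 * T ^ 2]. The others are
    nonnegative, so summing over all indices covers the random count. *)
Lemma bad_le_tail_mgf (t : 'I_T) h : size h = T -> in_range vbar h ->
  (bad_round (take t h))%:R <= (t == 0 :> nat)%N%:R +
    (2 * T%:R ^+ 2)^-1 * \sum_(i : (bool * bool) * 'I_T) tail_mgf (t, i) h.
Proof.
move=> hT hr.
have T0 : 0 < T%:R :> R by rewrite ltr0n.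
have c0 : 0 <= (2 * T%:R ^+ 2)^-1 :> R by rewrite invr_ge0 mulr_ge0// exprn_ge0// ltW.
have S0 : 0 <= \sum_(i : (bool * bool) * 'I_T) tail_mgf (t, i) h.
  by apply: sumr_ge0 => i _; exact: expR_ge0.
set g := take t h.
have gt : size g = t by rewrite /g size_takel// hT ltnW.
have gr : in_range vbar g by apply/allP => q /mem_take/(allP hr).
case bE : (bad_round g); last by rewrite addr_ge0// mulr_ge0.
move: bE; rewrite /bad gt; have [_|t0] := eqVneq (t : nat) 0%N.
  by move=> _; rewrite lerDl mulr_ge0.
rewrite /= add0r => /existsP[j].
have n0 : (0 < size (obs g))%N by apply: size_obs_gt0; rewrite gt lt0n.
have nT : (size (obs g) <= T)%N by rewrite (leq_trans (size_obs_le _ _ _ _ _))// gt ltnW.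
have xE : vnext v g = v t.+1 by rewrite /vnext gt.
have /andP[x0 _] := @v_range t.+1 (ltn_ord t).
have gobs : in_range vbar (obs g) by exact: obs_in_range.
rewrite xE radiusE // /dev xE.
set n := size (obs g) in n0 nT *; set x := v t.+1 in x0 xE *.
set e := ell R T * _; set D := _ * \sum_(q <- _) _ => nD.
(* A zero value makes all deviations vanish, which contradicts the strict violation. *)
have xgt0 : 0 < x.
  rewrite lt_def x0 andbT; apply/eqP => xz; move: nD; rewrite /D xz mulr0 mulr0.
  rewrite big1_seq ?mulr0 ?ltxx// => q /andP[_ /(allP gobs)/andP[q0 _]].
  have := stat_bounds j.1 q0 (lexx 0); have := mean_bounds j.1 (lexx 0).
  by move=> /andP[? ?] /andP[? ?]; lra.
have nn : (n.-1 < T)%N by rewrite prednK.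
have e0 : 0 <= e by rewrite mulr_ge0 ?invr_ge0 ?sqrtr_ge0.
have ne : n%:R * e ^+ 2 = (ln 2 + 2 * ln T%:R) / 2.
  rewrite /e exprMn exprVn sqr_sqrtr; last by rewrite divr_ge0// ln_sum_ge0.
  by rewrite sqr_sqrtr ?ler0n// mulrCA divff ?mulr1 ?pnatr_eq0 -?lt0n.
(* The violation [n * e * x < D] makes the exponent at least [2 * n * e ^+ 2 = ln 2 + 2 * ln T]. *)
have big : 2 * T%:R ^+ 2 <= tail_mgf (t, (j, Ordinal nn)) h.
  rewrite /tail_mgf /= hist_sum_cutoff prednK// -/e -/g -/x -obs_sum.
  have -> : \sum_(q <- obs g) tilt e x j q = 4 * e * (D / x) - n%:R * (2 * e ^+ 2).
    rewrite /tilt sumrB big_const_seq count_predT iter_addr_0 -/n.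
    rewrite -[_ *+ n]mulr_natl; congr (_ - _).
    by rewrite /D -mulr_sumr -mulr_suml -mulr_sumr.
  have -> : 2 * T%:R ^+ 2 = expR (ln 2 + 2 * ln T%:R) :> R.
    rewrite expRD lnK ?posrE// [2 * ln _]mulr_natl -lnXn// lnK// posrE.
    by rewrite exprn_gt0.
  rewrite ler_expR.
  have : 4 * e * (n%:R * e) <= 4 * e * (D / x).
    apply: ler_wpM2l; first exact: mulr_ge0 (ler0n _ 4) e0.
    rewrite ler_pdivlMr// -mulrA; exact: ltW.
  by rewrite expr2 in ne *; lra.
rewrite -[leLHS](@mulVf _ (2 * T%:R ^+ 2 : R)); last first.
  by rewrite mulf_neq0// expf_neq0// gt_eqF.
rewrite ler_wpM2l// (le_trans big)//.
by rewrite (bigD1 (j, Ordinal nn))//= lerDl; apply: sumr_ge0 => i _; exact: expR_ge0.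
Qed.

Lemma centered_stat j (a x : R) : 0 <= x -> `|a| <= 1 ->
  [/\ measurable_fun A (fun q => a * (stat j x q - mean j x)),
      forall q, A q -> `|a * (stat j x q - mean j x)| <= x &
      \int[G]_(q in A) (a * (stat j x q - mean j x)) = 0].
Proof.
move=> x0 a1; have /andP[m0 m1] := mean_bounds j x0.
have mc : measurable_fun A (fun q => stat j x q - mean j x).
  by apply: measurable_funB; [exact: measurable_stat|exact: measurable_cst].
have cx q : A q -> `|stat j x q - mean j x| <= x.
  move=> /A_ge0 q0; have /andP[s0 s1] := stat_bounds j q0 x0.
  by rewrite ler_norml; lra.
split.
- by apply: measurable_funM => //; exact: measurable_cst.
- by move=> q /cx qx; rewrite normrM -[leRHS]mul1r ler_pM.
- rewrite RintegralZl//; last exact: (bounded_integrable mA GA mc cx).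
  rewrite RintegralB//; last 2 first.
  + exact: integrable_stat.
  + apply: (bounded_integrable mA GA (M := `|mean j x|)) => [|q _ /=];
      [exact: measurable_cst|exact: lexx].
  by rewrite Rintegral_prob_cst// meanE subrr mulr0.
Qed.

(** The function [W] collects the terms of the pathwise bound, with bad rounds replaced by
    exponentials and the square compensated; its value at the empty history is the explicit
    bound. *)
Lemma expected_gap_ge :
  - (3 * (vbar * (2 + lam_max vbar rho T)) + vbar + vbar * Num.sqrt T%:R *
      (1 + 20 * ell R T + lam_max vbar rho T ^+ 2 / 2 + (1 + 2 * ell R T) ^+ 2))
  <= iid_expect G T (fun ps => ogd_revenue vbar rho T v (bids_of ps)
       - rho / vbar * hindsight rho T v (bids_of ps)).
Proof.
set k := rho / vbar; set L := vbar * (2 + _); set E := vbar * Num.sqrt _ * _.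
have k0 : 0 <= k by rewrite divr_ge0// ltW.
have k1 : k <= 1 by rewrite ler_pdivrMr// mul1r.
have T0 : 0 < T%:R :> R by rewrite ltr0n.
(* This choice balances the compensator [T * vbar ^ 2 / (2 * K)] against [K / 2]. *)
pose K := vbar * Num.sqrt T%:R.
have K0 : 0 < K by rewrite mulr_gt0// sqrtr_gt0.
have L0 : 0 <= L.
  have := lam_max_ge1 T vbar_gt0 rho_gt0; rewrite /L => m1.
  by apply: mulr_ge0; [exact: ltW|lra].
pose N1 := hist_sum (fun g q => ((act g)%:R - k) *
  (rew (vnext v g) q - mean_rew (vnext v g))).
pose N2 := hist_sum (fun g q => (act g)%:R *
  (cost (vnext v g) q - mean_cost (vnext v g))).
pose E0 := K / 2 + vbar + vbar * Num.sqrt T%:R *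
  (20 * ell R T + lam_max vbar rho T ^+ 2 / 2 + (1 + 2 * ell R T) ^+ 2).
pose cT : R := (2 * T%:R ^+ 2)^-1.
have cT0 : 0 <= cT by rewrite invr_ge0 mulr_ge0// exprn_ge0// ltW.
pose W h := N1 h + ((2 * K)^-1 * ((size h)%:R * vbar ^+ 2 - N2 h ^+ 2) +
  (L * cT * (\sum_(i : 'I_T * ((bool * bool) * 'I_T)) - tail_mgf i h) +
   (- (T%:R * vbar ^+ 2 / (2 * K)) - L - E0))).
have sW : submart vbar T G W.
  apply: submartD => //.
    apply: submart_hist_sum => // g gT gr.
    have /andP[x0 _] := vnext_range v_range gT.
    have ak : `|(act g)%:R - k| <= 1.
      by case: (act g) => /=; rewrite ler_norml; lra.
    have [mc cx c0] := centered_stat true x0 ak.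
    by split; [exact: (bounded_integrable mA GA mc cx)|exact: c0].
  apply: submartD => //.
    apply: submartZ => //; first by rewrite invr_ge0 mulr_ge0// ltW.
    apply: submart_hist_sum_sqr => // g gT gr.
    have /andP[x0 xv] := vnext_range v_range gT.
    have a1 : `|(act g)%:R : R| <= 1 by case: (act g); rewrite ?normr1 ?normr0.
    have [mc cx c0] := centered_stat false x0 a1.
    by split => // q /cx qx; exact: le_trans qx xv.
  apply: submartD => //; last exact: submart_cst.
  apply: submartZ => //; first exact: mulr_ge0.
  by apply: submart_sum => // i; exact: submart_tail_mgf.
apply: le_trans (iid_expect_ge GA (K := T%:R * vbar) _ sW _).
- rewrite /W /N1 /N2 !hist_sum_nil mul0r expr0n /= subr0 mulr0 !add0r.
  (* There are [4 * T ^ 2] exponentials, each starting at 1 with weight [L / (2 * T ^ 2)]: they cost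
     [2 * L], and the first round adds one more [L]. *)
  have -> : \sum_(i : 'I_T * ((bool * bool) * 'I_T)) - tail_mgf i [::] =
      - (4 * T%:R ^+ 2).
    under eq_bigr do rewrite /tail_mgf hist_sum_nil expR0.
    rewrite sumrN sumr_const !card_prod card_bool card_ord.
    by congr (- _); rewrite !natrM; ring.
  have -> : L * cT * - (4 * T%:R ^+ 2) = - (2 * L).
    by rewrite /cT; field; rewrite gt_eqF.
  have sT : Num.sqrt T%:R ^+ 2 = T%:R :> R by rewrite sqr_sqrtr// ler0n.
  have s0 : 0 < Num.sqrt T%:R :> R by rewrite sqrtr_gt0.
  have -> : T%:R * vbar ^+ 2 / (2 * K) = vbar * Num.sqrt T%:R / 2.
    by rewrite -{1}sT /K; field; rewrite !gt_eqF.
  by rewrite /E0 /E /K; lra.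
- by rewrite mulr_ge0// ltW.
move=> ps psT psr; apply/andP; split; last first.
  rewrite (ogd_revenue_hist _ _ _ psT) rev_hist_sum.
  have H0 : 0 <= hindsight rho T v (bids_of ps) by exact: bigmax_ge_id.
  have kH := mulr_ge0 k0 H0.
  suff : hist_sum (fun g q => (act g)%:R * rew (vnext v g) q) ps <= T%:R * vbar by lra.
  have <- : hist_sum (fun _ _ => vbar) ps = T%:R * vbar by rewrite hist_sum_cst psT.
  apply: (@le_hist_sum _ vbar T) => //; first by rewrite psT.
  move=> g q gT gr /andP[q0 _].
  have /andP[x0 xv] := vnext_range v_range gT.
  have /andP[r0 r1] := rew_bounds q0 x0.
  by case: (act g); rewrite ?mul1r ?mul0r ?(ltW vbar_gt0)//; exact: le_trans r1 xv.
rewrite (ogd_revenue_hist _ _ _ psT) rev_hist_sum.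
have Hle := ler_wpM2l k0 (hindsight_le rho v psT).
have rb x : 0 <= x -> 0 <= mean_rew x <= x by exact: (mean_bounds true).
have cb x : 0 <= x -> 0 <= mean_cost x <= x by exact: (mean_bounds false).
have := revenue_path vbar_gt0 rho_gt0 rho_le T_gt0 v_range rb cb K0 psT psr.
rewrite -/N1 -/N2 -/L -/k -/E0.
have BD : hist_sum (fun g _ => (bad_round g)%:R) ps <=
    1 + cT * \sum_(i : 'I_T * ((bool * bool) * 'I_T)) tail_mgf i ps.
  have -> : hist_sum (fun g _ => (bad_round g)%:R : R) ps =
      \sum_(t < T) (bad_round (take t ps))%:R.
    rewrite -(big_mkord xpredT (fun t => (bad_round (take t ps))%:R)) -psT.
    by rewrite big_mkord.
  apply: le_trans (ler_sum _ (fun t _ => bad_le_tail_mgf t psT psr)) _.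
  rewrite big_split /= lerD//.
    rewrite (bigD1 (Ordinal T_gt0))//= big1 ?addr0// => t /negbTE t0.
    by rewrite (_ : (t == 0 :> nat)%N = false).
  by rewrite -mulr_sumr pair_bigA /=; apply: ler_wpM2l => //; apply: ler_sum => -[].
have LBD := ler_wpM2l L0 BD.
rewrite /W psT sumrN.
have -> : (2 * K)^-1 * (T%:R * vbar ^+ 2 - N2 ps ^+ 2) =
    T%:R * vbar ^+ 2 / (2 * K) - N2 ps ^+ 2 / (2 * K).
  by rewrite mulrC mulrBl.
move: LBD Hle.
move: (\sum_i _) (hist_sum (fun g _ => (bad_round g)%:R) ps) => S B.
lra.
Qed.

End deviations.

(** * From the explicit bound to the limit *)

(* With [s = T ^ (1/4)], [ln T <= 4 * s], so that the loss of order
   [(1 + ln T) * sqrt T] is at most a multiple of [s ^ 3]. *)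
Lemma ln_le_root4 (R : realType) (s : R) : 1 <= s -> ln (s ^+ 4) <= 4 * s.
Proof.
move=> s1; have s0 : 0 < s by lra.
by rewrite lnXn// -[ln s *+ 4]mulr_natl ler_wpM2l// ltW// ln_sublinear.
Qed.

(* liminf_{T -> oo} inf_{v, G} (1/T) E[R^beta - (rho/vbar) R^H] >= 0,
   unfolded: for every eps > 0, eventually in T, uniformly in v and G,
   the normalized expected difference is >= -eps. *)
Theorem theorem7 (R : realType) (vbar rho : R) :
  0 < vbar -> 0 < rho -> rho <= vbar ->
  forall eps : R, 0 < eps ->
  exists T0 : nat, forall T : nat, (T0 <= T)%N ->
  forall (v : nat -> R), (forall t, (1 <= t <= T)%N -> 0 <= v t <= vbar) ->
  forall (G : probability R R), G `[0, vbar]%classic = 1%E ->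
    - eps <= T%:R^-1 *
      iid_expect G T (fun ps =>
        ogd_revenue vbar rho T v (bids_of ps)
        - rho / vbar * hindsight rho T v (bids_of ps)).
Proof.
move=> vbar_gt0 rho_gt0 rho_le eps eps_gt0.
(* With [u = 1 + ell], [a * u] bounds [lam_max], and [C] collects the coefficients of
   [u ^+ 2 * sqrt T] in the loss. *)
pose a := vbar / rho + 1.
pose C := vbar * (3 * (2 + a) + 26 + a ^+ 2 / 2).
have a0 : 0 < a by rewrite addr_gt0// divr_gt0.
have C0 : 0 < C.
  rewrite mulr_gt0// addr_gt0 ?divr_gt0 ?exprn_gt0// addr_gt0// mulr_gt0//.
  by rewrite addr_gt0.
(* The loss is at most [11 * C * s ^ 3] while [eps * T = eps * s ^ 4], so [b <= s] suffices. *)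
pose b := 11 * C / eps.
have b0 : 0 < b by rewrite divr_gt0// mulr_gt0.
exists (Num.bound (b ^+ 4)).+1 => T TT v v_range G GA.
have T_gt0 : (0 < T)%N by apply: leq_trans TT.
have := expected_gap_ge vbar_gt0 rho_gt0 rho_le T_gt0 v_range GA.
set X := iid_expect _ _ _; move=> gap.
have T0 : 0 < T%:R :> R by rewrite ltr0n.
rewrite mulrC ler_pdivlMr//; apply: le_trans gap; rewrite mulNr lerN2.
pose s := Num.sqrt (Num.sqrt T%:R) : R.
have s2 : Num.sqrt T%:R = s ^+ 2 by rewrite sqr_sqrtr// sqrtr_ge0.
have s4 : T%:R = s ^+ 4 by rewrite (exprM s 2 2) -s2 sqr_sqrtr// ler0n.
have s1 : 1 <= s.
  by rewrite -[leLHS]sqrtr1 ler_sqrt ?sqrtr_ge0// -[leLHS]sqrtr1 ler_sqrt// ler1n.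
have bs : b <= s.
  rewrite -(@ler_pXn2r _ 4)// ?nnegrE ?(ltW b0) ?(le_trans ler01 s1)//.
  rewrite -s4; apply/ltW; apply: lt_le_trans (archi_boundP _) _.
    by rewrite exprn_ge0// ltW.
  by rewrite ler_nat ltnW.
set l := ell R T; set m := lam_max vbar rho T.
have l0 : 0 <= l by exact: sqrtr_ge0.
pose u := 1 + l.
(* Here [u ^+ 2 <= 2 + 2 * l ^+ 2 = 2 + ln 2 + 2 * ln T <= 3 + 8 * s]. *)
have u2 : u ^+ 2 <= 11 * s.
  have l2 : l ^+ 2 = (ln 2 + 2 * ln T%:R) / 2.
    by rewrite sqr_sqrtr// divr_ge0// ln_sum_ge0.
  have ln2 : ln 2 <= 1 :> R.
    by rewrite -[X in ln X]/(1 + 1) le_ln1Dx//; lra.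
  have := ln_le_root4 s1; rewrite -s4 => lnT.
  have := sqr_ge0 (1 - l); rewrite /u; nra.
have mu : m <= a * u.
  have -> : m = vbar / rho * u + 1 by rewrite /m /lam_max -/l -/u mulrAC.
  by rewrite /a mulrDl mul1r lerD2l /u lerDl.
have m0 : 0 <= m by exact: le_trans ler01 (lam_max_ge1 T vbar_gt0 rho_gt0).
have u1 : 1 <= u by rewrite lerDl.
have u21 : 1 <= u ^+ 2 by rewrite exprn_ege1.
have uu2 : u <= u ^+ 2 by rewrite expr2 ler_peMl// (le_trans ler01).
have m2 : m ^+ 2 <= a ^+ 2 * u ^+ 2.
  by rewrite -exprMn lerXn2r ?nnegrE// mulr_ge0 ?(ltW a0)// (le_trans ler01).
have mu2 : m <= a * u ^+ 2.
  by apply: le_trans mu _; rewrite ler_wpM2l// ltW.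
have ll : (1 + 2 * l) ^+ 2 <= 4 * u ^+ 2 by rewrite /u; nra.
have lu : l <= u ^+ 2 by apply: le_trans uu2; rewrite /u; lra.
have q1 : 1 <= s ^+ 2 by rewrite exprn_ege1.
apply: (@le_trans _ _ (C * u ^+ 2 * s ^+ 2)); last first.
  apply: (@le_trans _ _ (C * (11 * s) * s ^+ 2)).
    by rewrite ler_wpM2r ?(le_trans ler01 q1)// ler_wpM2l// ltW.
  have -> : C * (11 * s) * s ^+ 2 = (b * eps) * s ^+ 3.
    by rewrite /b divfK ?gt_eqF//; ring.
  have -> : eps * T%:R = (s * eps) * s ^+ 3 by rewrite s4; ring.
  by rewrite ler_wpM2r ?exprn_ge0 ?(le_trans ler01 s1)// ler_wpM2r// ltW.
rewrite s2.
have f1 : 3 * (2 + m) + 1 <= (3 * (2 + a) + 1) * u ^+ 2 * s ^+ 2.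
  apply: (@le_trans _ _ ((3 * (2 + a) + 1) * u ^+ 2)); first by nra.
  by rewrite ler_peMr// mulr_ge0 ?sqr_ge0//; lra.
have f2 : 1 + 20 * l + m ^+ 2 / 2 + (1 + 2 * l) ^+ 2 <= (25 + a ^+ 2 / 2) * u ^+ 2.
  by lra.
have f3 := ler_wpM2r (le_trans ler01 q1) f2.
have := ler_wpM2l (ltW vbar_gt0) (lerD f1 f3).
rewrite /C; lra.
Qed.
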